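(* Let $A$ be an analytic function in $\mathbb{D}$ with $\|A\|_{\mathcal{L}^0}\leq 1$. If there exists one zero-free analytic solution in $\mathbb{D}$ of the differential equation $f''+Af=0$ which belongs to $\bigcup_{0<p<\infty}H^p$, then all analytic solutions in $\mathbb{D}$ of $f''+Af=0$ belong to $\bigcup_{0<p<\infty}H^p$.
   Context: $\mathbb{D}=\{z\in\mathbb{C}:|z|<1\}$ is the open unit disc. For $A$ analytic in $\mathbb{D}$, $\|A\|_{\mathcal{L}^0}=\sup_{z\in\mathbb{D}}|A(z)|(1-|z|^2)^2$. For $0<p<\infty$, the Hardy space $H^p$ consists of all functions $f$ analytic in $\mathbb{D}$ with $$\|f\|_{H^p}^p=\lim_{r\to1^-}\frac1{2\pi}\int_0^{2\pi}|f(re^{i\theta})|^p\,d\theta<\infty.$$ *)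

(* Defs.v *)
From Stdlib Require Import Reals.
From Coquelicot Require Import Coquelicot.

Open Scope R_scope.

Definition in_disc (z : C) : Prop := Cmod z < 1.

(* Functions on the disc are total functions on C; their values outside the
   open disc never matter. [C_AbsRing] makes [ex_derive] complex
   differentiability rather than real differentiability on R * R. *)
Definition analytic_in_disc (f : C -> C) : Prop :=
  forall z : C, in_disc z -> @ex_derive C_AbsRing C_NormedModule f z.

(* [C_derive] is total, so the existence of f'' is part of the definition:
   without it the equation could be about a junk value. *)
Definition analytic_solution (A f : C -> C) : Prop :=
  analytic_in_disc f /\ analytic_in_disc (C_derive f) /\
  forall z : C, in_disc z ->
    (C_derive (C_derive f) z + A z * f z)%C = RtoC 0.

Definition normL0 (A : C -> C) : Rbar :=
  Lub_Rbar (fun x : R => exists z : C,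
    in_disc z /\ x = Cmod (A z) * (1 - Cmod z ^ 2) ^ 2).

(* Stdlib has [Rpower 0 p = 1] (since [ln 0 = 0]), whereas the integrand
   |f|^p must vanish at the zeros of f. *)
Definition rpow (x p : R) : R := if Rlt_dec 0 x then Rpower x p else 0.

Definition circle_point (r theta : R) : C :=
  (r * cos theta, r * sin theta).

Definition hardy_mean (p : R) (f : C -> C) (r : R) : R :=
  1 / (2 * PI) *
  RInt (fun theta => rpow (Cmod (f (circle_point r theta))) p) 0 (2 * PI).

Definition in_Hardy (p : R) (f : C -> C) : Prop :=
  analytic_in_disc f /\
  exists l : R, filterlim (hardy_mean p f) (at_left 1) (locally l).

Definition in_some_Hardy (f : C -> C) : Prop :=
  exists p : R, 0 < p /\ in_Hardy p f.

(* Main.v *)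
Require Import Defs.
From Stdlib Require Import Reals Lra Lia.
From Coquelicot Require Import Coquelicot.

(** Let f be the zero-free solution lying in some Hardy space H^p, let g be any
    solution and put h = g / f.  The Wronskian w = g' f - g f' is constant, so
    h' = w / f^2.  Since g = f h, it is enough that h lies in H^q for some small
    q > 0: an arithmetic-geometric mean inequality then bounds the means of
    |g|^(q/2) by those of |f|^q and |h|^q.

    The usual route to [h in H^q] is that h is univalent by Nehari's criterion.
    Univalence is avoided here; a bound on the logarithmic derivative of f
    suffices.

    - [zero_free_log_derivative_bound]: (1 - |z|) |f'(z)| <= 20 |f(z)|.  On the
      disc of centre z0 and radius (1 - |z0|) / 5 the coefficient A is so small
      that f' is almost constant.  If |f'(z0)| were much larger than
      |f(z0)| / (1 - |z0|), then w |-> w - f(w) / f'(z0) would be a contraction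
      of this disc, and its fixed point would be a zero of f.

    - [power_mean_growth]: let I(r) be the integral over the circle of radius r
      of |f|^(-2q).  The Laplacian of |f|^(-2q) is 4 q^2 |f|^(-2q) |f'/f|^2, so
      that the logarithmic derivative bound gives
      (r I'(r))' <= 1600 q^2 r I(r) / (1 - r)^2, and, I being nondecreasing,
      I(r) <= I(0) (1 - r)^(-1600 q^2).  The exponent is quadratic in q.

    - [quotient_power_integral_bounded]: along the radii r_n = 1 - 2^(-n), the
      increment of h between r_n and r_(n+1) is at most a constant times
      2^(-n) / |f(r_n)|^2, because |f| varies by a bounded factor there.  For
      q <= 1 the function x |-> x^q is subadditive, so the mean of |h|^q at r_n
      is at most a constant plus a multiple of the sum of
      2^(-kq) I(r_k) <= I(0) 2^(-kq + 1600 q^2 k), a convergent geometric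
      series once q <= 1/3200.

    - [power_integral_nondecreasing]: the means of |g|^p increase with the
      radius, also when g has zeros, by subharmonicity of the smooth functions
      (|g|^2 + eps)^(p/2).  Bounded means along r_n therefore have a limit at 1. *)

(** * Complex derivatives *)

Notation has_C_derive g z l := (@is_derive C_AbsRing C_NormedModule g z l).

(** The plane with the product topology, on which real functions of two real
    variables live; the complex field also carries the topology of the modulus. *)
Notation C_plane := (prod_UniformSpace R_UniformSpace R_UniformSpace).

Lemma has_C_derive_small_o (g : C -> C) (z l : C) :
  has_C_derive g z l ->
  forall eps : posreal, exists d : posreal, forall y : C,
    Cmod (y - z)%C < d ->
    Cmod (g y - g z - (y - z) * l)%C <= eps * Cmod (y - z)%C.
Proof.
  intros [_ H] eps.
  destruct (H z (fun P HP => HP) eps) as [d Hd].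
  exists d. exact Hd.
Qed.

Lemma has_C_derive_of_small_o (g : C -> C) (z l : C) :
  (forall eps : posreal, exists d : posreal, forall y : C,
    Cmod (y - z)%C < d ->
    Cmod (g y - g z - (y - z) * l)%C <= eps * Cmod (y - z)%C) ->
  has_C_derive g z l.
Proof.
  intros H. split.
  - apply (is_linear_scal_l (K := C_AbsRing) (V := C_NormedModule)).
  - intros x Hx.
    apply (@is_filter_lim_locally_unique C_AbsRing (AbsRing_NormedModule C_AbsRing)) in Hx. subst x.
    intros eps. destruct (H eps) as [d Hd]. exists d. exact Hd.
Qed.

(** The field is a normed module over itself in two ways, which agree in
    norm but not as structures; product and chain rules use the other one. *)
Lemma has_C_derive_AbsRing (g : C -> C) (z l : C) :
  has_C_derive g z l <-> @is_derive C_AbsRing (AbsRing_NormedModule C_AbsRing) g z l.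
Proof.
  split; intros [[Hp Hs Hn] Hd]; (split; [ constructor; [ exact Hp | exact Hs | exact Hn ] | exact Hd ]).
Qed.

Lemma has_C_derive_mult (g h : C -> C) (z dg dh : C) :
  has_C_derive g z dg -> has_C_derive h z dh ->
  has_C_derive (fun w => g w * h w)%C z (dg * h z + g z * dh)%C.
Proof.
  rewrite !has_C_derive_AbsRing. intros Hg Hh.
  exact (is_derive_mult g h z dg dh Hg Hh Cmult_comm).
Qed.

Lemma has_C_derive_scal (g : C -> C) (c z dg : C) :
  has_C_derive g z dg -> has_C_derive (fun w => c * g w)%C z (c * dg)%C.
Proof.
  intros Hg. replace (c * dg)%C with (RtoC 0 * g z + c * dg)%C by ring.
  apply (has_C_derive_mult (fun _ => c)); [ | exact Hg ].
  apply (is_derive_const (K := C_AbsRing) (V := C_NormedModule)).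
Qed.

Lemma has_C_derive_sub (g h : C -> C) (z dg dh : C) :
  has_C_derive g z dg -> has_C_derive h z dh ->
  has_C_derive (fun w => g w - h w)%C z (dg - dh)%C.
Proof.
  apply (is_derive_minus (K := C_AbsRing) (V := C_NormedModule)).
Qed.

Lemma has_C_derive_id (z : C) : has_C_derive (fun w => w) z (RtoC 1).
Proof. rewrite has_C_derive_AbsRing. exact (is_derive_id z). Qed.

Lemma has_C_derive_inv (z : C) :
  z <> RtoC 0 -> has_C_derive Cinv z (- / (z * z))%C.
Proof.
  intros Hz. assert (Hm : 0 < Cmod z) by (apply Cmod_gt_0; exact Hz).
  apply has_C_derive_of_small_o. intros eps.
  set (m := Cmod z) in *.
  assert (Hd : 0 < Rmin (m / 2) (eps * m ^ 3 / 2)).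
  { apply Rmin_pos; [ lra | ]. apply Rdiv_lt_0_compat; [ | lra ].
    apply Rmult_lt_0_compat; [ apply cond_pos | apply pow_lt, Hm ]. }
  exists (mkposreal _ Hd). intros y Hy. simpl in Hy.
  assert (Hy1 := Rlt_le_trans _ _ _ Hy (Rmin_l _ _)).
  assert (Hy2 := Rlt_le_trans _ _ _ Hy (Rmin_r _ _)).
  assert (Hym : m / 2 < Cmod y).
  { assert (m <= Cmod y + Cmod (y - z)).
    { unfold m. replace z with (y - (y - z))%C at 1 by ring. rewrite <- (Cmod_opp (y - z)). apply Cmod_triangle. }
    lra. }
  assert (Hy0 : y <> RtoC 0) by (apply Cmod_gt_0; lra).
  replace (/ y - / z - (y - z) * - / (z * z))%C with ((y - z) * (y - z) / (y * (z * z)))%C by (field; split; assumption).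
  rewrite Cmod_div by (apply Cmult_neq_0; [ exact Hy0 | apply Cmult_neq_0; exact Hz ]).
  rewrite !Cmod_mult. fold m. set (e := Cmod (y - z)) in *.
  assert (He : 0 <= e) by apply Cmod_ge_0.
  apply (Rmult_le_reg_r (Cmod y * (m * m))). apply Rmult_lt_0_compat; nra.
  unfold Rdiv at 1. rewrite Rmult_assoc, Rinv_l by (apply Rgt_not_eq, Rmult_lt_0_compat; nra).
  assert (H1 : e <= eps * (Cmod y * (m * m))).
  { apply Rle_trans with (eps * (m / 2 * (m * m))). simpl in Hy2; lra.
    apply Rmult_le_compat_l. left; apply cond_pos. apply Rmult_le_compat_r; nra. }
  nra.
Qed.

Lemma has_C_derive_div (g f : C -> C) (z dg df : C) :
  has_C_derive g z dg -> has_C_derive f z df -> f z <> RtoC 0 ->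
  has_C_derive (fun w => g w / f w)%C z ((dg * f z - g z * df) / (f z * f z))%C.
Proof.
  intros Hg Hf H0.
  assert (Hi : has_C_derive (fun w => / f w)%C z (df * - / (f z * f z))%C).
  { apply (is_derive_comp (K := C_AbsRing) (V := C_NormedModule) Cinv f z).
    - apply has_C_derive_inv, H0.
    - apply has_C_derive_AbsRing, Hf. }
  replace ((dg * f z - g z * df) / (f z * f z))%C with (dg * / f z + g z * (df * - / (f z * f z)))%C by (field; exact H0).
  exact (has_C_derive_mult g (fun w => / f w)%C z _ _ Hg Hi).
Qed.

(** A complex derivative is in particular a real differential; its first
    component is the linear form [w |-> Re (w l)]. *)
Lemma filterdiff_fst_C (g : C -> C) (z l : C) :
  has_C_derive g z l ->
  filterdiff (fun w : prod_NormedModule R_AbsRing R_NormedModule R_NormedModule => fst (g (fst w, snd w)))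
    (@locally (prod_NormedModule R_AbsRing R_NormedModule R_NormedModule) z)
    (fun w => fst w * fst l - snd w * snd l).
Proof.
  intros H. split.
  - apply (is_linear_ext (fun w => plus (scal (fst l) (fst w)) (scal (- snd l) (snd w)))).
    + intros w. unfold plus, scal; simpl. unfold mult; simpl. ring.
    + apply (is_linear_comp (fun w => (scal (fst l) (fst w), scal (- snd l) (snd w))) (fun u => plus (fst u) (snd u))).
      * apply is_linear_prod.
        -- apply (is_linear_comp fst (fun u : R => scal (fst l) u)).
           apply is_linear_fst.
           apply (is_linear_scal_r (fst l) (V := R_NormedModule)). intros; apply Rmult_comm.
        -- apply (is_linear_comp snd (fun u : R => scal (- snd l) u)).
           apply is_linear_snd.
           apply (is_linear_scal_r (- snd l) (V := R_NormedModule)). intros; apply Rmult_comm.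
      * apply is_linear_plus.
  - intros x Hx.
    apply (@is_filter_lim_locally_unique R_AbsRing (prod_NormedModule R_AbsRing R_NormedModule R_NormedModule)) in Hx. subst x.
    intros eps.
    destruct (has_C_derive_small_o _ _ _ H eps) as [d Hd].
    assert (H2 : 0 < d / 2) by (destruct d; simpl; lra).
    exists (mkposreal _ H2). intros y [Hy1 Hy2].
    unfold ball in Hy1, Hy2; simpl in Hy1, Hy2.
    unfold AbsRing_ball, abs, minus, plus, opp in Hy1, Hy2; simpl in Hy1, Hy2.
    destruct y as [y1 y2], z as [z1 z2], l as [l1 l2]. simpl in *.
    assert (Hn : Cmod ((y1,y2) - (z1,z2))%C < d).
    { eapply Rle_lt_trans. apply Cmod_2Rmax. simpl.
      replace (sqrt 2) with (2 * / sqrt 2) .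
      2:{ apply (Rmult_eq_reg_r (sqrt 2)). rewrite Rmult_assoc, Rinv_l.
          rewrite sqrt_sqrt; lra. apply sqrt2_neq_0. apply sqrt2_neq_0. }
      assert (/ sqrt 2 <= 1).
      { rewrite <- Rinv_1. apply Rinv_le_contravar. lra.
        rewrite <- sqrt_1. apply sqrt_le_1_alt. lra. }
      assert (Rmax (Rabs (y1 + - z1)) (Rabs (y2 + - z2)) < d / 2).
      { apply Rmax_case; assumption. }
      assert (0 <= Rmax (Rabs (y1 + - z1)) (Rabs (y2 + - z2))).
      { eapply Rle_trans. apply Rabs_pos. apply Rmax_l. }
      nra. }
    specialize (Hd (y1,y2) Hn).
    eapply Rle_trans; [ | eapply Rle_trans; [ exact Hd | ] ].
    + eapply Rle_trans; [ | apply re_le_Cmod ].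
      unfold norm, minus, plus, opp; simpl. unfold abs, minus, plus, opp; simpl. right. f_equal.
    + apply Rmult_le_compat_l. left. apply cond_pos.
      right. unfold Cmod, norm, minus, plus, opp; simpl.
      unfold prod_norm, norm, abs; simpl. unfold abs; simpl.
      f_equal. change (plus y1 (opp z1)) with (y1 + - z1). change (plus y2 (opp z2)) with (y2 + - z2).
      generalize (pow2_abs (y1 + - z1)) (pow2_abs (y2 + - z2)). simpl. lra.
Qed.

Lemma continuous_fst_C (g : C -> C) (z l : C) :
  has_C_derive g z l ->
  @continuous C_plane R_UniformSpace (fun w => fst (g w)) z.
Proof.
  intros H.
  apply (continuous_ext (fun w : C_plane => fst (g (fst w, snd w)))).
  { intros [u v]; reflexivity. }
  apply (filterdiff_continuous (K := R_AbsRing)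
    (U := prod_NormedModule R_AbsRing R_NormedModule R_NormedModule) (V := R_NormedModule)).
  eexists. apply (filterdiff_fst_C g z l H).
Qed.

Lemma continuous_snd_C (g : C -> C) (z l : C) :
  has_C_derive g z l ->
  @continuous C_plane R_UniformSpace (fun w => snd (g w)) z.
Proof.
  intros H. apply (has_C_derive_scal _ (0, -1)), continuous_fst_C in H.
  eapply continuous_ext; [ | exact H ].
  intros w. simpl. ring.
Qed.

Lemma is_derive_fst_path (g : C -> C) (x y : R -> R) (t dx dy : R) (l : C) :
  has_C_derive g (x t, y t) l ->
  is_derive x t dx -> is_derive y t dy ->
  is_derive (fun s => fst (g (x s, y s))) t (fst l * dx - snd l * dy).
Proof.
  intros Hg Hx Hy.
  assert (H := filterdiff_comp'_2 (K:=R_AbsRing) x y (fun u v => fst (g (u, v))) t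
     (fun u => scal u dx) (fun u => scal u dy) (fun u v => u * fst l - v * snd l)
     Hx Hy (filterdiff_fst_C g (x t, y t) l Hg)).
  apply (filterdiff_ext_lin _ _ (fun u : R_AbsRing => scal u (fst l * dx - snd l * dy)) H).
  intros u. unfold scal; simpl. unfold mult; simpl. ring.
Qed.

(** The imaginary part of [g] is the real part of [-i g]. *)
Lemma is_derive_snd_path (g : C -> C) (x y : R -> R) (t dx dy : R) (l : C) :
  has_C_derive g (x t, y t) l ->
  is_derive x t dx -> is_derive y t dy ->
  is_derive (fun s => snd (g (x s, y s))) t (fst l * dy + snd l * dx).
Proof.
  intros Hg Hx Hy.
  assert (H := has_C_derive_scal g (0, -1) (x t, y t) l Hg).
  apply (is_derive_fst_path _ x y t dx dy) in H; try assumption.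
  eapply is_derive_ext; [ | eapply eq_ind; [ exact H | ] ].
  - intros s. simpl. ring.
  - simpl. ring.
Qed.

Lemma continuous_Cmod_path (g : C -> C) (x y : R -> R) (t : R) (l : C) :
  has_C_derive g (x t, y t) l ->
  continuous x t -> continuous y t ->
  continuous (fun s => Cmod (g (x s, y s))) t.
Proof.
  intros Hg Hx Hy. unfold Cmod.
  assert (H1 : continuous (fun s => fst (g (x s, y s))) t).
  { apply (continuous_comp_2 x y (fun u v => fst (g (u, v)))); try assumption.
    eapply continuous_ext; [ | exact (continuous_fst_C _ _ _ Hg) ]. intros [u v]; reflexivity. }
  assert (H2 : continuous (fun s => snd (g (x s, y s))) t).
  { apply (continuous_comp_2 x y (fun u v => snd (g (u, v)))); try assumption.
    eapply continuous_ext; [ | exact (continuous_snd_C _ _ _ Hg) ]. intros [u v]; reflexivity. }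
  apply (continuous_comp _ sqrt); [ | apply continuous_sqrt ].
  simpl.
  apply @continuous_plus; repeat apply @continuous_mult; try assumption; apply continuous_const.
Qed.

Lemma Cmod_sub_le_of_derive_bound (g g1 : C -> C) (z0 z : C) (B : R) :
  (forall t, 0 <= t <= 1 ->
     has_C_derive g (z0 + t * (z - z0))%C (g1 (z0 + t * (z - z0))%C) /\
     Cmod (g1 (z0 + t * (z - z0))%C) <= B) ->
  Cmod (g z - g z0) <= B * Cmod (z - z0).
Proof.
  intros H.
  (* projecting on the direction of [g z - g z0] reduces to the real mean value theorem *)
  set (w := (g z - g z0)%C).
  destruct z0 as [p0 q0]. destruct z as [p q].
  set (X := fun t => p0 + t * (p - p0)). set (Y := fun t => q0 + t * (q - q0)).
  assert (HX : forall t : R, ((p0, q0) + t * ((p, q) - (p0, q0)))%C = (X t, Y t)).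
  { intros t. unfold X, Y. apply injective_projections; simpl; ring. }
  set (phi := fun t => fst w * fst (g (X t, Y t)) + snd w * snd (g (X t, Y t))).
  set (dphi := fun t => let l := g1 (X t, Y t) in
    fst w * (fst l * (p - p0) - snd l * (q - q0)) + snd w * (fst l * (q - q0) + snd l * (p - p0))).
  assert (Hd : forall t, 0 <= t <= 1 -> is_derive phi t (dphi t)).
  { intros t Ht. destruct (H t Ht) as [H1 _]. rewrite HX in H1.
    assert (HdX : is_derive X t (p - p0)) by (unfold X; auto_derive; [ trivial | ring ]).
    assert (HdY : is_derive Y t (q - q0)) by (unfold Y; auto_derive; [ trivial | ring ]).
    apply @is_derive_plus; apply is_derive_scal.
    - apply (is_derive_fst_path g X Y); assumption.
    - apply (is_derive_snd_path g X Y); assumption. }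
  destruct (MVT_gen phi 0 1 dphi) as [c [Hc E]].
  - intros t. rewrite Rmin_left, Rmax_right by lra. intros Ht. apply Hd; lra.
  - intros t. rewrite Rmin_left, Rmax_right by lra. intros Ht.
    apply continuity_pt_filterlim. apply (ex_derive_continuous phi). eexists. apply Hd; lra.
  - rewrite Rmin_left, Rmax_right in Hc by lra.
    destruct (H c Hc) as [_ HB]. rewrite HX in HB.
    assert (E1 : phi 1 - phi 0 = Cmod w ^ 2).
    { unfold phi. replace (X 1, Y 1) with (p, q) by (unfold X, Y; f_equal; ring).
      replace (X 0, Y 0) with (p0, q0) by (unfold X, Y; f_equal; ring).
      unfold Cmod. rewrite pow2_sqrt by nra. unfold w; simpl. ring. }
    assert (E2 : dphi c <= Cmod w * (Cmod (g1 (X c, Y c)) * Cmod ((p, q) - (p0, q0))%C)).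
    { rewrite <- (Cmod_conj w), <- !Cmod_mult.
      eapply Rle_trans; [ | eapply Rle_trans; [ apply Rle_abs | apply re_le_Cmod ] ].
      right. unfold dphi; simpl. ring. }
    destruct (Rle_lt_or_eq_dec _ _ (Cmod_ge_0 w)) as [Hw | Hw].
    + assert (Cmod w * Cmod w <= Cmod w * (B * Cmod ((p, q) - (p0, q0))%C)).
      { replace (Cmod w * Cmod w) with (dphi c) by (transitivity (phi 1 - phi 0); [rewrite E; ring | rewrite E1; ring]).
        eapply Rle_trans; [ exact E2 | ]. apply Rmult_le_compat_l. lra.
        apply Rmult_le_compat_r. apply Cmod_ge_0. exact HB. }
      apply Rmult_le_reg_l in H0; assumption.
    + rewrite <- Hw. apply Rmult_le_pos; [ | apply Cmod_ge_0 ].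
      eapply Rle_trans; [ apply Cmod_ge_0 | exact HB ].
Qed.

(** * Fixed points of contractions of a disc *)

Lemma ex_finite_lim_seq_geometric_steps (u : nat -> R) (D k : R) :
  0 <= k < 1 ->
  (forall n, Rabs (u (S n) - u n) <= D * k ^ n) ->
  exists l : R, is_lim_seq u l.
Proof.
  intros Hk Hu.
  assert (Hs : ex_series (fun n => u (S n) - u n)).
  { apply (ex_series_le (V := R_CompleteNormedModule) _ (fun n => D * k ^ n)).
    - exact Hu.
    - apply (ex_series_scal_l (V := R_NormedModule) D (fun n => k ^ n)). apply ex_series_geom. rewrite Rabs_pos_eq; lra. }
  destruct Hs as [l Hl]. exists (l + u 0%nat).
  apply is_lim_seq_incr_1.
  apply (is_lim_seq_ext (fun n => sum_n (fun n => u (S n) - u n) n + u 0%nat)).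
  - intros n. induction n as [ | n IH ].
    + rewrite sum_O. ring.
    + rewrite sum_Sn. unfold plus; simpl. lra.
  - apply (is_lim_seq_plus _ _ l (u 0%nat)).
    + exact Hl.
    + apply is_lim_seq_const.
    + reflexivity.
Qed.

Lemma Cmod_le_Rabs (z : C) : Cmod z <= Rabs (fst z) + Rabs (snd z).
Proof.
  unfold Cmod. apply Rsqr_incr_0_var.
  - rewrite Rsqr_sqrt by nra. unfold Rsqr.
    rewrite <- (pow2_abs (fst z)), <- (pow2_abs (snd z)).
    generalize (Rabs_pos (fst z)) (Rabs_pos (snd z)). intros. nra.
  - generalize (Rabs_pos (fst z)) (Rabs_pos (snd z)). lra.
Qed.

Lemma im_le_Cmod (z : C) : Rabs (snd z) <= Cmod z.
Proof.
  rewrite <- sqrt_Rsqr_abs. unfold Cmod. apply sqrt_le_1_alt. unfold Rsqr. nra.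
Qed.

Lemma Cmod_sub_comm (z w : C) : Cmod (z - w) = Cmod (w - z).
Proof. rewrite <- Cmod_opp. f_equal. ring. Qed.

Lemma Cmod_sub_triangle (x y z : C) : Cmod (x - z) <= Cmod (x - y) + Cmod (y - z).
Proof.
  replace (x - z)%C with ((x - y) + (y - z))%C by ring. apply Cmod_triangle.
Qed.

Lemma contraction_fixed_point (T : C -> C) (z0 : C) (rho k : R) :
  0 <= k < 1 -> 0 <= rho ->
  (forall v w, Cmod (v - z0) <= rho -> Cmod (w - z0) <= rho ->
     Cmod (T v - T w) <= k * Cmod (v - w)) ->
  Cmod (T z0 - z0) <= (1 - k) * rho ->
  exists w, Cmod (w - z0) <= rho /\ T w = w.
Proof.
  intros Hk Hr HT H0.
  set (s := fix s (n : nat) : C := match n with O => z0 | S n => T (s n) end).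
  assert (Hz0 : Cmod (z0 - z0) <= rho).
  { replace (z0 - z0)%C with (RtoC 0) by ring. rewrite Cmod_0. exact Hr. }
  assert (Hin : forall n, Cmod (s n - z0) <= rho).
  { induction n as [ | n IH ]; [ exact Hz0 | ].
    simpl. eapply Rle_trans. apply (Cmod_sub_triangle _ (T z0)).
    specialize (HT _ _ IH Hz0). nra. }
  assert (Hstep : forall n, Cmod (s (S n) - s n) <= (1 - k) * rho * k ^ n).
  { induction n as [ | n IH ].
    - simpl. lra.
    - simpl in *. eapply Rle_trans. apply (HT (T (s n)) (s n)); [ apply (Hin (S n)) | apply Hin ].
      apply (Rmult_le_compat_l k) in IH; lra. }
  destruct (ex_finite_lim_seq_geometric_steps (fun n => fst (s n)) ((1 - k) * rho) k Hk) as [a Ha].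
  { intros n. eapply Rle_trans; [ | apply Hstep ]. exact (re_le_Cmod (s (S n) - s n)%C). }
  destruct (ex_finite_lim_seq_geometric_steps (fun n => snd (s n)) ((1 - k) * rho) k Hk) as [b Hb].
  { intros n. eapply Rle_trans; [ | apply Hstep ]. exact (im_le_Cmod (s (S n) - s n)%C). }
  set (w := (a, b) : C).
  assert (Hlim : is_lim_seq (fun n => Cmod (s n - w)) 0).
  { apply (is_lim_seq_le_le (fun _ => 0) _ (fun n => Rabs (fst (s n) - a) + Rabs (snd (s n) - b))).
    - intros n. split. apply Cmod_ge_0. apply (Cmod_le_Rabs (s n - w)%C).
    - apply is_lim_seq_const.
    - replace (Finite 0) with (Rbar_plus (Rabs (a - a)) (Rabs (b - b))).
      2:{ simpl. f_equal. rewrite !Rminus_diag, Rabs_R0. ring. }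
      apply is_lim_seq_plus'.
      + apply (is_lim_seq_abs _ (a - a)). apply is_lim_seq_minus'. exact Ha. apply is_lim_seq_const.
      + apply (is_lim_seq_abs _ (b - b)). apply is_lim_seq_minus'. exact Hb. apply is_lim_seq_const. }
  assert (Hw : Cmod (w - z0) <= rho).
  { assert (L := is_lim_seq_plus' _ (fun _ => rho) 0 rho Hlim (is_lim_seq_const rho)).
    apply (is_lim_seq_le (fun n => Cmod (w - z0)) _ (Cmod (w - z0)) _) in L.
    - simpl in L. lra.
    - intros n. eapply Rle_trans. apply (Cmod_sub_triangle _ (s n)).
      rewrite (Cmod_sub_comm w). apply Rplus_le_compat_l. apply Hin.
    - apply is_lim_seq_const. }
  exists w. split. exact Hw.
  assert (Cmod (T w - w) <= 0).
  { assert (L2 : is_lim_seq (fun n => k * Cmod (s n - w) + Cmod (s (S n) - w)) (k * 0 + 0)).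
    { apply is_lim_seq_plus'.
      - apply (is_lim_seq_scal_l _ k 0). exact Hlim.
      - apply (is_lim_seq_incr_1 (fun n => Cmod (s n - w))). exact Hlim. }
    apply (is_lim_seq_le (fun n => Cmod (T w - w)) _ (Cmod (T w - w)) _) in L2.
    - simpl in L2. lra.
    - intros n. eapply Rle_trans. apply (Cmod_sub_triangle _ (s (S n))).
      apply Rplus_le_compat_r. simpl. rewrite (Cmod_sub_comm (s n)). apply HT. exact Hw. apply Hin.
    - apply is_lim_seq_const. }
  assert (E : (T w - w)%C = RtoC 0).
  { apply Cmod_eq_0. apply Rle_antisym. assumption. apply Cmod_ge_0. }
  replace (T w) with ((T w - w) + w)%C by ring. rewrite E. ring.
Qed.

(** * The logarithmic derivative of a zero-free solution *)

Lemma segment_in_ball (z0 w : C) (rho t : R) :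
  Cmod (w - z0) <= rho -> 0 <= t <= 1 ->
  Cmod (z0 + t * (w - z0) - z0)%C <= rho.
Proof.
  intros Hw Ht.
  replace (z0 + t * (w - z0) - z0)%C with (t * (w - z0))%C by ring.
  rewrite Cmod_mult, Cmod_R, Rabs_pos_eq by lra.
  generalize (Cmod_ge_0 (w - z0)). nra.
Qed.

Lemma segment_between_in_ball (z0 v w : C) (rho t : R) :
  Cmod (v - z0) <= rho -> Cmod (w - z0) <= rho -> 0 <= t <= 1 ->
  Cmod (v + t * (w - v) - z0)%C <= rho.
Proof.
  intros Hv Hw Ht.
  replace (v + t * (w - v) - z0)%C with ((1 - t)%R * (v - z0) + t * (w - z0))%C
    by (rewrite RtoC_minus; ring).
  eapply Rle_trans; [ apply Cmod_triangle | ].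
  rewrite !Cmod_mult, !Cmod_R, !Rabs_pos_eq by lra.
  generalize (Cmod_ge_0 (w - z0)) (Cmod_ge_0 (v - z0)). nra.
Qed.

Section ZeroFreeSolution.

Variables A f f1 : C -> C.
Hypothesis Hf : forall z, Cmod z < 1 -> has_C_derive f z (f1 z).
Hypothesis Hf1 : forall z, Cmod z < 1 -> has_C_derive f1 z (- (A z * f z))%C.
Hypothesis HA : forall z, Cmod z < 1 -> Cmod (A z) * (1 - Cmod z ^ 2) ^ 2 <= 1.
Hypothesis Hf0 : forall z, Cmod z < 1 -> f z <> RtoC 0.

(** With radius [rho = (1 - |z0|) / 5] the points [w] of the disc satisfy
    [1 - |w|^2 >= 4 rho], so the hypothesis on the coefficient becomes
    [16 rho^2 |A w| <= 1]. *)
Lemma coefficient_bound_near (z0 w : C) :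
  Cmod z0 < 1 -> Cmod (w - z0) <= (1 - Cmod z0) / 5 ->
  Cmod w < 1 /\ Cmod (A w) * ((1 - Cmod z0) / 5) ^ 2 <= 1 / 16.
Proof.
  intros Hz Hw.
  assert (H1 : Cmod w <= Cmod z0 + (1 - Cmod z0) / 5).
  { replace w with (z0 + (w - z0))%C by ring. eapply Rle_trans. apply Cmod_triangle. lra. }
  assert (Hw1 : Cmod w < 1) by lra.
  split; [ exact Hw1 | ].
  specialize (HA w Hw1).
  generalize (Cmod_ge_0 w) (Cmod_ge_0 (A w)); intros.
  assert (4 * ((1 - Cmod z0) / 5) <= 1 - Cmod w ^ 2) by nra.
  assert ((4 * ((1 - Cmod z0) / 5)) ^ 2 <= (1 - Cmod w ^ 2) ^ 2) by (apply pow_incr; lra).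
  apply (Rmult_le_compat_l (Cmod (A w))) in H3; [ lra | assumption ].
Qed.

(** Let [S] be the maximum of [|f|] on the segment from [z0] to [w], and [rho] the
    radius.  The equation bounds the variation of [f'] there by [S / (16 rho)], hence that
    of [f] by [rho |f'(z0)| + S / 16]; this makes [S] at most [16/15] times
    [|f(z0)| + rho |f'(z0)|], and the bound on [S] feeds back into the first one. *)
Lemma derivative_variation_near (z0 w : C) :
  Cmod z0 < 1 -> Cmod (w - z0) <= (1 - Cmod z0) / 5 ->
  Cmod (f1 w - f1 z0) * ((1 - Cmod z0) / 5)
    <= (Cmod (f z0) + Cmod (f1 z0) * ((1 - Cmod z0) / 5)) / 15.
Proof.
  intros Hz Hw. set (rho := (1 - Cmod z0) / 5) in *.
  assert (Hrho : 0 < rho) by (unfold rho; lra).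
  set (p := fun t : R => (z0 + t * (w - z0))%C).
  assert (Hp : forall t, 0 <= t <= 1 -> Cmod (p t - z0) <= rho).
  { intros t Ht. apply segment_in_ball; assumption. }
  destruct (continuity_ab_maj (fun t => Cmod (f (p t))) 0 1) as [t0 [Hmax Ht0]]; [ lra | | ].
  { intros t Ht. apply continuity_pt_filterlim.
    assert (E : forall s : R, p s = (fst z0 + s * (fst w - fst z0), snd z0 + s * (snd w - snd z0))).
    { intros s. apply injective_projections; simpl; ring. }
    apply (continuous_ext (fun s => Cmod (f (fst z0 + s * (fst w - fst z0), snd z0 + s * (snd w - snd z0))))).
    { intros s. rewrite E. reflexivity. }
    apply (continuous_Cmod_path f (fun s => fst z0 + s * (fst w - fst z0)) (fun s => snd z0 + s * (snd w - snd z0)) t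
      (f1 (p t))).
    - rewrite <- E. apply Hf. apply (coefficient_bound_near z0 (p t) Hz). apply Hp; exact Ht.
    - apply (ex_derive_continuous (fun s : R => fst z0 + s * (fst w - fst z0))). auto_derive. trivial.
    - apply (ex_derive_continuous (fun s : R => snd z0 + s * (snd w - snd z0))). auto_derive. trivial. }
  set (S := Cmod (f (p t0))) in *.
  assert (HS0 : 0 <= S) by apply Cmod_ge_0.
  assert (Hvar : forall t, 0 <= t <= 1 -> Cmod (f1 (p t) - f1 z0) * rho <= S / 16).
  { intros t Ht.
    assert (Hb : Cmod (f1 (p t) - f1 z0) <= (S / 16 / rho ^ 2) * Cmod (p t - z0)).
    { apply (Cmod_sub_le_of_derive_bound f1 (fun v => - (A v * f v))%C).
      intros s Hs.
      assert (E : (z0 + s * (p t - z0))%C = p (s * t)).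
      { unfold p. rewrite RtoC_mult. ring. }
      rewrite E.
      assert (Hst : 0 <= s * t <= 1) by nra.
      destruct (coefficient_bound_near z0 (p (s * t)) Hz (Hp _ Hst)) as [Hd HAb].
      split. apply Hf1; exact Hd.
      rewrite Cmod_opp, Cmod_mult.
      fold rho in HAb.
      apply (Rmult_le_reg_r (rho ^ 2)). nra.
      replace (S / 16 / rho ^ 2 * rho ^ 2) with (1 / 16 * S) by (field; lra).
      specialize (Hmax _ Hst). fold S in Hmax.
      replace (Cmod (A (p (s * t))) * Cmod (f (p (s * t))) * rho ^ 2)
        with ((Cmod (A (p (s * t))) * rho ^ 2) * Cmod (f (p (s * t)))) by ring.
      apply Rmult_le_compat; try assumption.
      apply Rmult_le_pos. apply Cmod_ge_0. nra. apply Cmod_ge_0. }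
    assert (Cmod (f1 (p t) - f1 z0) <= (S / 16 / rho ^ 2) * rho).
    { eapply Rle_trans. exact Hb. apply Rmult_le_compat_l.
      apply Rmult_le_pos. lra. left. apply Rinv_0_lt_compat. nra. apply Hp; exact Ht. }
    apply (Rmult_le_compat_r rho) in H; [ | lra ].
    replace (S / 16 / rho ^ 2 * rho * rho) with (S / 16) in H by (field; lra). exact H. }
  assert (HS : S <= Cmod (f z0) + Cmod (f1 z0) * rho + S / 16).
  { assert (Hb : Cmod (f (p t0) - f z0) <= (Cmod (f1 z0) + S / 16 / rho) * Cmod (p t0 - z0)).
    { apply (Cmod_sub_le_of_derive_bound f f1). intros s Hs.
      assert (E : (z0 + s * (p t0 - z0))%C = p (s * t0)).
      { unfold p. rewrite RtoC_mult. ring. }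
      rewrite E.
      assert (Hst : 0 <= s * t0 <= 1) by nra.
      destruct (coefficient_bound_near z0 (p (s * t0)) Hz (Hp _ Hst)) as [Hd _].
      split. apply Hf; exact Hd.
      replace (f1 (p (s * t0)%R)) with (f1 z0 + (f1 (p (s * t0)%R) - f1 z0))%C by ring.
      eapply Rle_trans. apply Cmod_triangle.
      apply Rplus_le_compat_l. apply (Rmult_le_reg_r rho). exact Hrho.
      replace (S / 16 / rho * rho) with (S / 16) by (field; lra). apply Hvar; exact Hst. }
    assert (Hc : (Cmod (f1 z0) + S / 16 / rho) * Cmod (p t0 - z0) <= (Cmod (f1 z0) + S / 16 / rho) * rho).
    { apply Rmult_le_compat_l. apply Rplus_le_le_0_compat. apply Cmod_ge_0.
      apply Rmult_le_pos. lra. left. apply Rinv_0_lt_compat. lra. apply Hp; exact Ht0. }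
    replace ((Cmod (f1 z0) + S / 16 / rho) * rho) with (Cmod (f1 z0) * rho + S / 16) in Hc by (field; lra).
    assert (S <= Cmod (f z0) + Cmod (f (p t0) - f z0)).
    { unfold S. replace (f (p t0)) with (f z0 + (f (p t0) - f z0))%C at 1 by ring. apply Cmod_triangle. }
    lra. }
  assert (Hw1 : w = p 1) by (unfold p; ring).
  specialize (Hvar 1). rewrite <- Hw1 in Hvar.
  specialize (Hvar (conj Rle_0_1 (Rle_refl 1))). lra.
Qed.

(** Otherwise [|f(z0)| < rho |f'(z0)| / 4], so by the previous lemma [f'] stays
    within [|f'(z0)| / 12] of [f'(z0)] on the disc.  The simplified Newton map
    [w |-> w - f w / f'(z0)] is then a contraction of the disc into itself, and
    its fixed point is a zero of [f]. *)
Lemma zero_free_log_derivative_bound (z0 : C) :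
  Cmod z0 < 1 -> Cmod (f1 z0) * (1 - Cmod z0) <= 20 * Cmod (f z0).
Proof.
  intros Hz. apply Rnot_lt_le. intros Hlt.
  set (rho := (1 - Cmod z0) / 5).
  assert (Hrho : 0 < rho) by (unfold rho; lra).
  assert (Hbig : 4 * Cmod (f z0) < Cmod (f1 z0) * rho) by (unfold rho; lra).
  assert (Hpos : 0 < Cmod (f1 z0)).
  { generalize (Cmod_ge_0 (f z0)) (Cmod_ge_0 (f1 z0)). intros. nra. }
  assert (Hne : f1 z0 <> RtoC 0) by (apply Cmod_gt_0; exact Hpos).
  destruct (contraction_fixed_point (fun w => w - f w / f1 z0)%C z0 rho (1 / 12)) as [w [Hw Ew]].
  - lra.
  - lra.
  - intros v w Hv Hw.
    replace (v - f v / f1 z0 - (w - f w / f1 z0))%C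
      with (- (((f v - f1 z0 * v) - (f w - f1 z0 * w)) / f1 z0))%C by (field; exact Hne).
    rewrite Cmod_opp, Cmod_div by exact Hne.
    assert (Hb : Cmod ((f v - f1 z0 * v) - (f w - f1 z0 * w))%C <= (Cmod (f1 z0) / 12) * Cmod (v - w)).
    { apply (Cmod_sub_le_of_derive_bound (fun u => f u - f1 z0 * u)%C (fun u => f1 u - f1 z0)%C).
      intros t Ht.
      assert (Hin := segment_between_in_ball z0 w v rho t Hw Hv Ht).
      set (u := (w + t * (v - w))%C) in *.
      split.
      - destruct (coefficient_bound_near z0 u Hz Hin) as [Hd _].
        apply (has_C_derive_sub f (fun u => f1 z0 * u)%C).
        + apply Hf; exact Hd.
        + assert (Hs := has_C_derive_scal (fun u => u) (f1 z0) u 1 (has_C_derive_id u)).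
          rewrite Cmult_1_r in Hs. exact Hs.
      - apply (Rmult_le_reg_r rho). exact Hrho.
        eapply Rle_trans. apply (derivative_variation_near z0 u Hz Hin).
        fold rho. lra. }
    apply (Rmult_le_reg_r (Cmod (f1 z0))). exact Hpos.
    unfold Rdiv at 1. rewrite Rmult_assoc, Rinv_l by lra. lra.
  - replace (z0 - f z0 / f1 z0 - z0)%C with (- (f z0 / f1 z0))%C by ring.
    rewrite Cmod_opp, Cmod_div by exact Hne.
    apply (Rmult_le_reg_r (Cmod (f1 z0))). exact Hpos.
    unfold Rdiv at 1. rewrite Rmult_assoc, Rinv_l by lra. nra.
  - assert (E : f w = RtoC 0).
    { replace (f w) with (- f1 z0 * ((w - f w / f1 z0) - w))%C by (field; exact Hne).
      rewrite Ew. ring. }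
    revert E. apply Hf0.
    apply (coefficient_bound_near z0 w Hz Hw).
Qed.

End ZeroFreeSolution.

(** * Means over circles in polar coordinates *)

Lemma nondecreasing_of_derive_nonneg (f df : R -> R) (x y : R) :
  x <= y ->
  (forall u, x < u < y -> is_derive f u (df u) /\ 0 <= df u) ->
  (forall u, x <= u <= y -> continuous f u) ->
  f x <= f y.
Proof.
  intros Hxy Hd Hc.
  destruct (Rle_lt_or_eq_dec _ _ Hxy) as [Hlt | E]; [ | rewrite E; lra ].
  assert (Hd0 : forall u, x < u < y -> derivable_pt_lim f u (df u)).
  { intros u Hu. apply is_derive_Reals. apply Hd, Hu. }
  destruct (MVT f id x y (fun u Hu => exist _ (df u) (Hd0 u Hu)) (fun u _ => derivable_pt_id u) Hlt)
    as [c [Hcc E]].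
  - intros u Hu. apply continuity_pt_filterlim, Hc, Hu.
  - intros u Hu. apply derivable_continuous_pt, derivable_pt_id.
  - rewrite derive_pt_id in E. unfold id in E. simpl in E.
    destruct (Hd c Hcc) as [_ Hpos]. nra.
Qed.

Lemma is_derive_RInt_parameter (F dF : R -> R -> R) (r : R) :
  Rabs r < 1 ->
  (forall s t, Rabs s < 1 -> is_derive (fun u => F u t) s (dF s t)) ->
  (forall s t, Rabs s < 1 -> continuous (F s) t) ->
  (forall s t, Rabs s < 1 ->
     @continuous C_plane R_UniformSpace (fun w => dF (fst w) (snd w)) (s, t)) ->
  is_derive (fun s => RInt (F s) 0 (2 * PI)) r (RInt (dF r) 0 (2 * PI)).
Proof.
  intros Hr Hd Hc Hdc.
  assert (Hloc : locally r (fun s : R => Rabs s < 1)).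
  { apply (continuous_Rabs r (fun v => v < 1)). apply (open_lt 1). exact Hr. }
  replace (RInt (dF r) 0 (2 * PI)) with (RInt (fun t => Derive (fun u => F u t) r) 0 (2 * PI)).
  2:{ apply RInt_ext. intros t _. apply is_derive_unique. apply Hd; exact Hr. }
  apply (is_derive_RInt_param F 0 (2 * PI) r).
  - eapply filter_imp; [ | exact Hloc ]. intros s Hs t _. eexists. apply Hd; exact Hs.
  - intros t _.
    apply (continuity_2d_pt_ext_loc dF).
    + apply locally_2d_locally.
      assert (H2 := @continuous_fst R_UniformSpace R_UniformSpace r t _ Hloc).
      eapply filter_imp; [ | exact H2 ]. intros [u v] Hu. symmetry. apply is_derive_unique. apply Hd. exact Hu.
    + apply continuity_2d_pt_filterlim. apply Hdc. exact Hr.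
  - eapply filter_imp; [ | exact Hloc ]. intros s Hs.
    apply (ex_RInt_continuous (V := R_CompleteNormedModule) (F s)). intros t _. apply Hc; exact Hs.
Qed.

Lemma continuous_second_slice (F : R -> R -> R) (s t : R) :
  @continuous C_plane R_UniformSpace (fun w => F (fst w) (snd w)) (s, t) ->
  continuous (F s) t.
Proof.
  intros H. apply (continuous_comp_2 (fun _ => s) (fun t => t) F t).
  - apply continuous_const.
  - apply continuous_id.
  - exact H.
Qed.

Lemma is_derive_Rpower_sq (p q : R -> R) (eps k t dp dq : R) :
  is_derive p t dp -> is_derive q t dq -> 0 < p t ^ 2 + q t ^ 2 + eps ->
  is_derive (fun s => Rpower (p s ^ 2 + q s ^ 2 + eps) k) t
    (2 * k * Rpower (p t ^ 2 + q t ^ 2 + eps) k * (p t * dp + q t * dq) / (p t ^ 2 + q t ^ 2 + eps)).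
Proof.
  intros Hp Hq HU. unfold Rpower.
  auto_derive.
  - repeat split; try (eexists; eassumption). lra.
  - rewrite (is_derive_unique (fun s : R => p s) t _ Hp), (is_derive_unique (fun s : R => q s) t _ Hq).
    replace (p t * (p t * 1)) with (p t ^ 2) by ring.
    replace (q t * (q t * 1)) with (q t ^ 2) by ring.
    field. lra.
Qed.

(** The same formula serves for the radial and the angular second derivative of
    [(p^2 + q^2 + eps)^k]: in each case [(a, b)] is the first derivative of
    [(p, q)] in that direction. *)
Lemma is_derive_Rpower_sq_flux (p q a b : R -> R) (eps k t dp dq da db : R) :
  is_derive p t dp -> is_derive q t dq -> is_derive a t da -> is_derive b t db ->
  0 < p t ^ 2 + q t ^ 2 + eps ->
  let U := p t ^ 2 + q t ^ 2 + eps in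
  is_derive (fun s => 2 * k * Rpower (p s ^ 2 + q s ^ 2 + eps) k * (p s * a s + q s * b s)
                       / (p s ^ 2 + q s ^ 2 + eps)) t
    (Rpower U k * (4 * k * (k - 1) * (p t * dp + q t * dq) * (p t * a t + q t * b t) / U ^ 2
       + 2 * k * (dp * a t + p t * da + dq * b t + q t * db) / U)).
Proof.
  intros Hp Hq Ha Hb HU U.
  assert (HF := is_derive_Rpower_sq p q eps k t dp dq Hp Hq HU).
  set (F := fun s => Rpower (p s ^ 2 + q s ^ 2 + eps) k) in *.
  apply (is_derive_ext (fun s => 2 * k * F s * (p s * a s + q s * b s) / (p s ^ 2 + q s ^ 2 + eps))).
  { intros s. reflexivity. }
  auto_derive.
  - repeat split; try (eexists; eassumption). lra.
  - rewrite (is_derive_unique (fun s : R => p s) t _ Hp), (is_derive_unique (fun s : R => q s) t _ Hq), (is_derive_unique (fun s : R => a s) t _ Ha),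
      (is_derive_unique (fun s : R => b s) t _ Hb), (is_derive_unique (fun s : R => F s) t _ HF).
    fold U. change (Rpower U k) with (F t).
    replace (p t * (p t * 1) + q t * (q t * 1) + eps) with U by (unfold U; ring).
    field. unfold U; lra.
Qed.

Definition polar_continuous (F : R -> R -> R) : Prop :=
  forall r t, Rabs r < 1 ->
    @continuous C_plane R_UniformSpace (fun w => F (fst w) (snd w)) (r, t).

Lemma polar_continuous_const c : polar_continuous (fun _ _ => c).
Proof. intros r t _. apply continuous_const. Qed.

Lemma polar_continuous_radius : polar_continuous (fun r _ => r).
Proof. intros r t _. apply continuous_fst. Qed.

Lemma polar_continuous_plus F G :
  polar_continuous F -> polar_continuous G -> polar_continuous (fun r t => F r t + G r t).
Proof. intros HF HG r t Hr. apply @continuous_plus; [ apply HF | apply HG ]; exact Hr. Qed.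

Lemma polar_continuous_mult F G :
  polar_continuous F -> polar_continuous G -> polar_continuous (fun r t => F r t * G r t).
Proof. intros HF HG r t Hr. apply @continuous_mult; [ apply HF | apply HG ]; exact Hr. Qed.

Lemma polar_continuous_pow F n :
  polar_continuous F -> polar_continuous (fun r t => F r t ^ n).
Proof.
  intros HF. induction n as [ | n IH ]; [ exact (polar_continuous_const 1) | ].
  exact (polar_continuous_mult _ _ HF IH).
Qed.

Lemma polar_continuous_inv F :
  (forall r t, Rabs r < 1 -> F r t <> 0) ->
  polar_continuous F -> polar_continuous (fun r t => / F r t).
Proof.
  intros H0 HF r t Hr.
  apply (continuous_comp (fun w : C_plane => F (fst w) (snd w)) Rinv).
  apply HF; exact Hr. apply continuous_Rinv. simpl. apply H0; exact Hr.
Qed.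

Lemma polar_continuous_Rpower F k :
  (forall r t, Rabs r < 1 -> 0 < F r t) ->
  polar_continuous F -> polar_continuous (fun r t => Rpower (F r t) k).
Proof.
  intros H0 HF r t Hr.
  apply (continuous_comp (fun w : C_plane => k * ln (F (fst w) (snd w))) exp); [ | apply continuous_exp ].
  apply @continuous_mult; [ apply continuous_const | ].
  apply (continuous_comp (fun w : C_plane => F (fst w) (snd w)) ln).
  apply HF; exact Hr. apply continuous_ln. simpl. apply H0; exact Hr.
Qed.

Lemma polar_continuous_ext F G :
  (forall r t, F r t = G r t) -> polar_continuous F -> polar_continuous G.
Proof.
  intros E HF r t Hr. eapply continuous_ext; [ | apply HF; exact Hr ].
  intros w. apply E.
Qed.

Ltac polar_cont :=
  repeat first
    [ assumption
    | apply polar_continuous_plus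
    | apply polar_continuous_mult
    | apply polar_continuous_pow
    | apply polar_continuous_const
    | apply polar_continuous_radius ].

(** In this section [(p, q)] are the real and imaginary parts of an analytic
    function [g] at the point of polar coordinates [(r, t)], with
    [a + i b = e^(i t) g'] and [al + i be = e^(2 i t) g''].  The hypotheses on the
    angular derivatives are the Cauchy-Riemann equations.  [Phi] is
    [(|g|^2 + eps)^k], [D] and [D'] are its first and second radial derivatives
    and [L] is its Laplacian. *)
Section PolarMean.

Variables p q a b al be : R -> R -> R.
Variables eps k : R.

Hypothesis Hpr : forall r t, Rabs r < 1 -> is_derive (fun s => p s t) r (a r t).
Hypothesis Hqr : forall r t, Rabs r < 1 -> is_derive (fun s => q s t) r (b r t).
Hypothesis Har : forall r t, Rabs r < 1 -> is_derive (fun s => a s t) r (al r t).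
Hypothesis Hbr : forall r t, Rabs r < 1 -> is_derive (fun s => b s t) r (be r t).
Hypothesis Hpt : forall r t, Rabs r < 1 -> is_derive (p r) t (- r * b r t).
Hypothesis Hqt : forall r t, Rabs r < 1 -> is_derive (q r) t (r * a r t).
Hypothesis Hat : forall r t, Rabs r < 1 -> is_derive (a r) t (- b r t - r * be r t).
Hypothesis Hbt : forall r t, Rabs r < 1 -> is_derive (b r) t (a r t + r * al r t).
Hypothesis Cp : polar_continuous p.
Hypothesis Cq : polar_continuous q.
Hypothesis Ca : polar_continuous a.
Hypothesis Cb : polar_continuous b.
Hypothesis Cal : polar_continuous al.
Hypothesis Cbe : polar_continuous be.
Hypothesis Pp : forall r, p r (2 * PI) = p r 0.
Hypothesis Pq : forall r, q r (2 * PI) = q r 0.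
Hypothesis Pa : forall r, a r (2 * PI) = a r 0.
Hypothesis Pb : forall r, b r (2 * PI) = b r 0.
Hypothesis HU : forall r t, Rabs r < 1 -> 0 < p r t ^ 2 + q r t ^ 2 + eps.

Let U r t := p r t ^ 2 + q r t ^ 2 + eps.
Let Phi r t := Rpower (U r t) k.
Let D r t := 2 * k * Phi r t * (p r t * a r t + q r t * b r t) / U r t.
Let D' r t := Phi r t * (4 * k * (k - 1) * (p r t * a r t + q r t * b r t) * (p r t * a r t + q r t * b r t) / U r t ^ 2
       + 2 * k * (a r t * a r t + p r t * al r t + b r t * b r t + q r t * be r t) / U r t).
Let L r t := 4 * k * Phi r t * (a r t ^ 2 + b r t ^ 2) * (eps + k * (p r t ^ 2 + q r t ^ 2)) / U r t ^ 2.

Let CU : polar_continuous U.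
Proof. unfold U. polar_cont. Qed.

Let CUinv : polar_continuous (fun r t => / U r t).
Proof.
  apply polar_continuous_inv; [ | exact CU ].
  intros r t Hr. apply Rgt_not_eq, HU, Hr.
Qed.

Let CUinv2 : polar_continuous (fun r t => / U r t ^ 2).
Proof.
  apply polar_continuous_inv; [ | apply polar_continuous_pow; exact CU ].
  intros r t Hr. apply pow_nonzero, Rgt_not_eq, HU, Hr.
Qed.

Let CPhi : polar_continuous Phi.
Proof. apply polar_continuous_Rpower; [ exact HU | exact CU ]. Qed.

Let CD : polar_continuous D.
Proof. unfold D, Rdiv. polar_cont. Qed.

Let CD' : polar_continuous D'.
Proof. unfold D', Rdiv. polar_cont. Qed.

Let CL : polar_continuous L.
Proof. unfold L, Rdiv. polar_cont. Qed.

Let int (F : R -> R -> R) (r : R) : R := RInt (F r) 0 (2 * PI).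

Lemma polar_mean_derive (r : R) : Rabs r < 1 -> is_derive (int Phi) r (int D r).
Proof.
  intros Hr. apply (is_derive_RInt_parameter Phi D); [ exact Hr | | | ].
  - intros s t Hs. apply (is_derive_Rpower_sq (fun u => p u t) (fun u => q u t) eps k s). apply Hpr, Hs. apply Hqr, Hs. apply HU, Hs.
  - intros s t Hs. apply continuous_second_slice, CPhi, Hs.
  - exact CD.
Qed.

Lemma polar_ex_RInt F r : polar_continuous F -> Rabs r < 1 -> ex_RInt (F r) 0 (2 * PI).
Proof.
  intros CF Hr. apply (ex_RInt_continuous (V := R_CompleteNormedModule) (F r)).
  intros t _. apply continuous_second_slice, CF, Hr.
Qed.

Lemma polar_flux_derive (r : R) :
  Rabs r < 1 ->
  is_derive (fun s => s * int D s) r (int (fun s t => D s t + s * D' s t) r).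
Proof.
  intros Hr.
  assert (H : is_derive (int D) r (int D' r)).
  { apply (is_derive_RInt_parameter D D'); [ exact Hr | | | exact CD' ].
    - intros s t Hs. apply (is_derive_Rpower_sq_flux (fun u => p u t) (fun u => q u t) (fun u => a u t) (fun u => b u t) eps k s); auto.
    - intros s t Hs. apply continuous_second_slice, CD, Hs. }
  replace (int (fun s t => D s t + s * D' s t) r) with (1 * int D r + r * int D' r).
  - apply (is_derive_mult (K := R_AbsRing) (fun s => s) (int D)); [ apply @is_derive_id | exact H | exact Rmult_comm ].
  - symmetry. unfold int.
    etransitivity.
    + apply (RInt_plus (V := R_CompleteNormedModule) (D r) (fun t => r * D' r t)).
      * apply polar_ex_RInt; [ exact CD | exact Hr ].
      * apply (polar_ex_RInt (fun r t => r * D' r t)); [ polar_cont | exact Hr ].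
    + unfold plus; simpl. rewrite Rmult_1_l. f_equal.
      apply (RInt_scal (V := R_CompleteNormedModule) (D' r)).
      apply polar_ex_RInt; [ exact CD' | exact Hr ].
Qed.

(** In polar coordinates [r^2] times the Laplacian of [Phi] is
    [r d/dr (r dPhi/dr) + d^2 Phi/dt^2].  The last term, a derivative of a
    periodic function, integrates to zero. *)
Lemma polar_flux_derive_eq (r : R) :
  Rabs r < 1 ->
  r * int (fun s t => D s t + s * D' s t) r = r ^ 2 * int L r.
Proof.
  intros Hr.
  set (T := fun t => 2 * k * Phi r t * (p r t * (- r * b r t) + q r t * (r * a r t)) / U r t).
  set (T' := fun t => r ^ 2 * L r t - r * (D r t + r * D' r t)).
  assert (C1 : polar_continuous (fun r t => r ^ 2 * L r t)) by polar_cont.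
  assert (C2 : polar_continuous (fun r t => r * (D r t + r * D' r t))) by polar_cont.
  assert (C3 : polar_continuous (fun r t => D r t + r * D' r t)) by polar_cont.
  assert (H : is_RInt T' 0 (2 * PI) (minus (T (2 * PI)) (T 0))).
  { apply (is_RInt_derive T T').
    - intros t _.
      assert (Hda : is_derive (fun t => r * a r t) t (r * (- b r t - r * be r t))).
      { apply is_derive_scal. apply Hat, Hr. }
      assert (Hdb : is_derive (fun t => - r * b r t) t (- r * (a r t + r * al r t))).
      { apply is_derive_scal. apply Hbt, Hr. }
      assert (Hd := is_derive_Rpower_sq_flux (p r) (q r) (fun t => - r * b r t) (fun t => r * a r t) eps k t
        _ _ _ _ (Hpt r t Hr) (Hqt r t Hr) Hdb Hda (HU r t Hr)).
      cbv zeta in Hd.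
      change (is_derive T t (T' t)).
      replace (T' t) with
      (Rpower (p r t ^ 2 + q r t ^ 2 + eps) k *
       (4 * k * (k - 1) * (p r t * (- r * b r t) + q r t * (r * a r t)) *
        (p r t * (- r * b r t) + q r t * (r * a r t)) / (p r t ^ 2 + q r t ^ 2 + eps) ^ 2 +
        2 * k *
        (- r * b r t * (- r * b r t) + p r t * (- r * (a r t + r * al r t)) +
         r * a r t * (r * a r t) + q r t * (r * (- b r t - r * be r t))) /
        (p r t ^ 2 + q r t ^ 2 + eps))).
      exact Hd.
      unfold T', L, D, D', Phi, U.
      generalize (Rpower (p r t ^ 2 + q r t ^ 2 + eps) k). intros X.
      field. apply Rgt_not_eq, HU, Hr.
    - intros t _. apply (continuous_minus (fun t => r ^ 2 * L r t) (fun t => r * (D r t + r * D' r t))).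
      + apply (continuous_second_slice _ _ _ (C1 r t Hr)).
      + apply (continuous_second_slice _ _ _ (C2 r t Hr)). }
  assert (E0 : T (2 * PI) = T 0).
  { unfold T, Phi, U. rewrite Pp, Pq, Pa, Pb. reflexivity. }
  rewrite E0 in H. apply (is_RInt_unique (V := R_CompleteNormedModule)) in H.
  assert (E1 : RInt T' 0 (2 * PI) = RInt (fun t => r ^ 2 * L r t) 0 (2 * PI) - RInt (fun t => r * (D r t + r * D' r t)) 0 (2 * PI)).
  { apply (RInt_minus (V := R_CompleteNormedModule) (fun t => r ^ 2 * L r t) (fun t => r * (D r t + r * D' r t))).
    apply (polar_ex_RInt _ _ C1 Hr). apply (polar_ex_RInt _ _ C2 Hr). }
  assert (E2 : RInt (fun t => r ^ 2 * L r t) 0 (2 * PI) = r ^ 2 * int L r).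
  { apply (RInt_scal (V := R_CompleteNormedModule) (L r)). apply (polar_ex_RInt _ _ CL Hr). }
  assert (E3 : RInt (fun t => r * (D r t + r * D' r t)) 0 (2 * PI) = r * int (fun s t => D s t + s * D' s t) r).
  { apply (RInt_scal (V := R_CompleteNormedModule) (fun t => D r t + r * D' r t)). apply (polar_ex_RInt _ _ C3 Hr). }
  rewrite <- E2, <- E3. rewrite E1 in H.
  change (minus (T 0) (T 0)) with (T 0 + - T 0) in H.
  rewrite Rplus_opp_r in H. symmetry. exact (Rminus_diag_uniq _ _ H).
Qed.

(** The hypothesis says that the Laplacian of [Phi] is nonnegative; the flux
    then increases from its value zero at the origin. *)
Lemma polar_flux_nonneg (s : R) :
  (forall r t, Rabs r < 1 -> 0 <= k * (eps + k * (p r t ^ 2 + q r t ^ 2))) ->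
  0 <= s < 1 -> 0 <= s * int D s.
Proof.
  intros Hk Hs.
  replace 0 with (0 * int D 0) by ring.
  apply (nondecreasing_of_derive_nonneg (fun s => s * int D s) (fun s => int (fun s t => D s t + s * D' s t) s)).
  - lra.
  - intros u Hu. assert (Hu1 : Rabs u < 1) by (rewrite Rabs_pos_eq; lra).
    split. apply polar_flux_derive, Hu1.
    apply (Rmult_le_reg_l u); [ lra | ]. rewrite Rmult_0_r, (polar_flux_derive_eq u Hu1).
    apply Rmult_le_pos; [ nra | ].
    apply RInt_ge_0.
    + generalize PI_RGT_0; lra.
    + apply (polar_ex_RInt L); [ exact CL | exact Hu1 ].
    + intros t _. unfold L, Rdiv.
      apply Rmult_le_pos; [ | left; apply Rinv_0_lt_compat, pow_lt, HU, Hu1 ].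
      replace (4 * k * Phi u t * (a u t ^ 2 + b u t ^ 2) * (eps + k * (p u t ^ 2 + q u t ^ 2)))
        with (4 * Phi u t * (a u t ^ 2 + b u t ^ 2) * (k * (eps + k * (p u t ^ 2 + q u t ^ 2)))) by ring.
      apply Rmult_le_pos; [ | apply Hk, Hu1 ].
      apply Rmult_le_pos; [ | nra ].
      apply Rmult_le_pos; [ lra | left; apply exp_pos ].
  - intros u Hu. apply (ex_derive_continuous (fun s => s * int D s)).
    eexists. apply polar_flux_derive. rewrite Rabs_pos_eq; lra.
Qed.

Lemma polar_mean_nondecreasing (r1 r2 : R) :
  (forall r t, Rabs r < 1 -> 0 <= k * (eps + k * (p r t ^ 2 + q r t ^ 2))) ->
  0 <= r1 -> r1 <= r2 -> r2 < 1 -> int Phi r1 <= int Phi r2.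
Proof.
  intros Hk H1 H12 H2.
  apply (nondecreasing_of_derive_nonneg (int Phi) (int D)); [ exact H12 | | ].
  - intros u Hu. split.
    + apply polar_mean_derive. rewrite Rabs_pos_eq; lra.
    + apply (Rmult_le_reg_l u); [ lra | ]. rewrite Rmult_0_r. apply polar_flux_nonneg; [ exact Hk | lra ].
  - intros u Hu. apply (ex_derive_continuous (int Phi)).
    eexists. apply polar_mean_derive. rewrite Rabs_pos_eq; lra.
Qed.

(** With [eps = 0], [M] the mean of [Phi] and [N = r M'] its flux, the hypothesis
    gives [N' <= K u M / (1 - u)^2], where [K = 4 k^2 B].  As [M] is
    nondecreasing, integrating from [0] to [s] with [M] replaced by [M s] yields
    [N s <= K M(s) s / (1 - s)], that is, [M' / M <= K / (1 - s)]. *)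
Lemma polar_mean_growth (B r : R) :
  eps = 0 ->
  (forall r t, 0 <= r < 1 -> (a r t ^ 2 + b r t ^ 2) * (1 - r) ^ 2 <= B * (p r t ^ 2 + q r t ^ 2)) ->
  0 <= r < 1 ->
  int Phi r * Rpower (1 - r) (4 * k ^ 2 * B) <= int Phi 0.
Proof.
  intros He HB Hr.
  assert (Hk : forall r t, Rabs r < 1 -> 0 <= k * (eps + k * (p r t ^ 2 + q r t ^ 2))).
  { intros s t _. rewrite He.
    replace (k * (0 + k * (p s t ^ 2 + q s t ^ 2))) with (k ^ 2 * (p s t ^ 2 + q s t ^ 2)) by ring.
    apply Rmult_le_pos; nra. }
  set (K := 4 * k ^ 2 * B).
  assert (HB0 : 0 <= B).
  { assert (H0 := HB 0 0 ltac:(lra)).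
    assert (HU0 := HU 0 0 ltac:(rewrite Rabs_R0; lra)). rewrite He in HU0.
    assert (0 <= (a 0 0 ^ 2 + b 0 0 ^ 2) * (1 - 0) ^ 2) by nra. nra. }
  assert (HK : 0 <= K) by (unfold K; nra).
  assert (HM : forall u, 0 <= u < 1 -> 0 <= int Phi u).
  { intros u Hu. apply RInt_ge_0. generalize PI_RGT_0; lra.
    apply (polar_ex_RInt Phi); [ exact CPhi | rewrite Rabs_pos_eq; lra ].
    intros t _. left. apply exp_pos. }
  assert (HL : forall u, 0 <= u < 1 -> int L u <= K / (1 - u) ^ 2 * int Phi u).
  { intros u Hu. assert (Hu1 : Rabs u < 1) by (rewrite Rabs_pos_eq; lra).
    replace (K / (1 - u) ^ 2 * int Phi u) with (RInt (fun t => K / (1 - u) ^ 2 * Phi u t) 0 (2 * PI)).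
    2:{ apply (RInt_scal (V := R_CompleteNormedModule) (Phi u)).
        apply (polar_ex_RInt Phi); [ exact CPhi | exact Hu1 ]. }
    assert (C1 : polar_continuous (fun _ t => K / (1 - u) ^ 2 * Phi u t)).
    { intros s t _. apply (continuous_comp snd (fun t => K / (1 - u) ^ 2 * Phi u t)).
      apply continuous_snd. simpl. apply (continuous_scal_r (V := R_NormedModule) (K / ((1 - u) * ((1 - u) * 1))) (Phi u)).
      apply continuous_second_slice, CPhi, Hu1. }
    apply RInt_le.
    - generalize PI_RGT_0; lra.
    - apply (polar_ex_RInt L); [ exact CL | exact Hu1 ].
    - apply (polar_ex_RInt _ u C1 Hu1).
    - intros t _. specialize (HB u t Hu). specialize (HU u t Hu1).
      assert (HPhi : 0 < Phi u t) by apply exp_pos.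
      unfold L, U. fold K. rewrite He in *.
      set (w := p u t ^ 2 + q u t ^ 2) in *. set (v := a u t ^ 2 + b u t ^ 2) in *.
      rewrite Rplus_0_r in *. rewrite Rplus_0_l.
      assert (Hu2 : 0 < (1 - u) ^ 2) by (apply pow_lt; lra).
      apply (Rmult_le_reg_r ((1 - u) ^ 2 * w)); [ nra | ].
      replace (4 * k * Phi u t * v * (k * w) / w ^ 2 * ((1 - u) ^ 2 * w))
        with (4 * k ^ 2 * Phi u t * (v * (1 - u) ^ 2)) by (field; lra).
      replace (K / (1 - u) ^ 2 * Phi u t * ((1 - u) ^ 2 * w))
        with (4 * k ^ 2 * Phi u t * (B * w)) by (unfold K; field; lra).
      apply Rmult_le_compat_l; [ | exact HB ].
      apply Rmult_le_pos; [ nra | lra ]. }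
  assert (HN : forall s, 0 <= s < 1 -> s * int D s <= K * int Phi s * (s / (1 - s))).
  { intros s Hs.
    assert (H : 0 <= K * int Phi s * (s / (1 - s)) - s * int D s); [ | lra ].
    replace 0 with (K * int Phi s * (0 / (1 - 0)) - 0 * int D 0) by (unfold Rdiv; ring).
    apply (nondecreasing_of_derive_nonneg (fun u => K * int Phi s * (u / (1 - u)) - u * int D u)
             (fun u => K * int Phi s * (/ (1 - u) ^ 2) - int (fun s t => D s t + s * D' s t) u)).
    - lra.
    - intros u Hu. assert (Hu1 : Rabs u < 1) by (rewrite Rabs_pos_eq; lra). split.
      + apply (is_derive_minus (fun u => K * int Phi s * (u / (1 - u))) (fun u => u * int D u)); [ | apply polar_flux_derive, Hu1 ].
        apply is_derive_scal. auto_derive. lra. field. lra.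
      + assert (E : int (fun s t => D s t + s * D' s t) u = u * int L u).
        { apply (Rmult_eq_reg_l u); [ | lra ]. rewrite (polar_flux_derive_eq u Hu1). ring. }
        rewrite E.
        assert (Hm : int Phi u <= int Phi s) by (apply polar_mean_nondecreasing; [ exact Hk | lra.. ]).
        specialize (HL u ltac:(lra)).
        assert (H1 : u * int L u <= u * (K / (1 - u) ^ 2 * int Phi u)) by (apply Rmult_le_compat_l; lra).
        assert (Hi : 0 <= K / (1 - u) ^ 2).
        { apply Rmult_le_pos; [ exact HK | ]. left. apply Rinv_0_lt_compat, pow_lt; lra. }
        assert (H2 : u * (K / (1 - u) ^ 2 * int Phi u) <= 1 * (K / (1 - u) ^ 2 * int Phi s)).
        { apply Rmult_le_compat; [ lra | | lra | apply Rmult_le_compat_l; lra ].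
          apply Rmult_le_pos; [ exact Hi | apply HM; lra ]. }
        unfold Rdiv in *. lra.
    - intros u Hu. apply (ex_derive_continuous (fun u => K * int Phi s * (u / (1 - u)) - u * int D u)).
      eexists. apply (is_derive_minus (fun u => K * int Phi s * (u / (1 - u))) (fun u => u * int D u)).
      + apply is_derive_scal. auto_derive. lra. reflexivity.
      + apply polar_flux_derive. rewrite Rabs_pos_eq; lra. }
  set (G := fun u => - (int Phi u * Rpower (1 - u) K)).
  assert (HG : forall u, 0 <= u < 1 -> is_derive G u (Rpower (1 - u) K * (K * int Phi u / (1 - u) - int D u))).
  { intros u Hu. assert (Hu1 : Rabs u < 1) by (rewrite Rabs_pos_eq; lra).
    assert (HMd := polar_mean_derive u Hu1).
    unfold G, Rpower. auto_derive.
    - split; [ eexists; exact HMd | split; [ lra | trivial ] ].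
    - rewrite (is_derive_unique (fun s : R => int Phi s) u _ HMd). change (1 + - u) with (1 - u). generalize (exp (K * ln (1 - u))) (int D u) (int Phi u). intros X Y Z. field. lra. }
  assert (Hfin : G 0 <= G r).
  { apply (nondecreasing_of_derive_nonneg G (fun u => Rpower (1 - u) K * (K * int Phi u / (1 - u) - int D u))).
    - lra.
    - intros u Hu. split. apply HG; lra.
      apply Rmult_le_pos. left; apply exp_pos.
      apply (Rmult_le_reg_l u); [ lra | ]. rewrite Rmult_0_r.
      specialize (HN u ltac:(lra)).
      replace (K * int Phi u * (u / (1 - u))) with (u * (K * int Phi u / (1 - u))) in HN by (field; lra).
      lra.
    - intros u Hu. apply (ex_derive_continuous G). eexists. apply HG; lra. }
  unfold G in Hfin. rewrite Rminus_0_r in Hfin.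
  assert (E1 : Rpower 1 K = 1) by (unfold Rpower; rewrite ln_1, Rmult_0_r; apply exp_0).
  rewrite E1 in Hfin. lra.
Qed.

End PolarMean.

(** * Power means of analytic functions *)

Definition twice_C_derivable_in_disc (g g1 g2 : C -> C) : Prop :=
  forall z, Cmod z < 1 ->
    has_C_derive g z (g1 z) /\ has_C_derive g1 z (g2 z) /\
    @continuous C_plane R_UniformSpace (fun w => fst (g2 w)) z /\
    @continuous C_plane R_UniformSpace (fun w => snd (g2 w)) z.

Lemma Cmod_circle_point r t : Cmod (circle_point r t) = Rabs r.
Proof.
  unfold Cmod, circle_point; simpl.
  replace (r * cos t * (r * cos t * 1) + r * sin t * (r * sin t * 1))
    with (r² * ((sin t)² + (cos t)²)) by (unfold Rsqr; ring).
  rewrite sin2_cos2, Rmult_1_r. apply sqrt_Rsqr_abs.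
Qed.

Lemma circle_point_2PI r : circle_point r (2 * PI) = circle_point r 0.
Proof. unfold circle_point. rewrite cos_2PI, sin_2PI, cos_0, sin_0. reflexivity. Qed.

Lemma sq_Cmod (z : C) : Cmod z ^ 2 = fst z ^ 2 + snd z ^ 2.
Proof. unfold Cmod. apply pow2_sqrt. nra. Qed.

Lemma polar_continuous_comp (h : C -> R) :
  (forall z : C, Cmod z < 1 -> @continuous C_plane R_UniformSpace h z) ->
  polar_continuous (fun r t => h (circle_point r t)).
Proof.
  intros H r t Hr. unfold circle_point.
  apply (continuous_comp_2 (fun w : C_plane => fst w * cos (snd w)) (fun w : C_plane => fst w * sin (snd w))
    (fun x y => h (x, y))).
  - apply @continuous_mult; [ apply continuous_fst | ].
    apply (continuous_comp snd cos); [ apply continuous_snd | apply continuous_cos ].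
  - apply @continuous_mult; [ apply continuous_fst | ].
    apply (continuous_comp snd sin); [ apply continuous_snd | apply continuous_sin ].
  - eapply continuous_ext; [ | apply (H (circle_point r t)) ].
    + intros [x y]; reflexivity.
    + rewrite Cmod_circle_point. exact Hr.
Qed.

Lemma polar_continuous_angle (F : R -> R) :
  (forall t, continuous F t) -> polar_continuous (fun _ t => F t).
Proof.
  intros HF r t _. apply (continuous_comp snd F); [ apply continuous_snd | apply HF ].
Qed.

(** Multiplication of [u + i v] by [e^(i t)], the factor that radial
    differentiation brings out of an analytic function. *)
Definition rot_re (u v : R -> R -> R) r t := cos t * u r t - sin t * v r t.
Definition rot_im (u v : R -> R -> R) r t := cos t * v r t + sin t * u r t.

Lemma is_derive_rot_re_radius (u v du dv : R -> R -> R) r t :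
  is_derive (fun s => u s t) r (du r t) -> is_derive (fun s => v s t) r (dv r t) ->
  is_derive (fun s => rot_re u v s t) r (rot_re du dv r t).
Proof.
  intros Hu Hv. unfold rot_re.
  apply @is_derive_minus; apply is_derive_scal; assumption.
Qed.

Lemma is_derive_rot_im_radius (u v du dv : R -> R -> R) r t :
  is_derive (fun s => u s t) r (du r t) -> is_derive (fun s => v s t) r (dv r t) ->
  is_derive (fun s => rot_im u v s t) r (rot_im du dv r t).
Proof.
  intros Hu Hv. unfold rot_im.
  apply @is_derive_plus; apply is_derive_scal; assumption.
Qed.

Lemma is_derive_fst_radius (g : C -> C) (l : C) r t :
  has_C_derive g (circle_point r t) l ->
  is_derive (fun s => fst (g (circle_point s t))) r (cos t * fst l - sin t * snd l).
Proof.
  intros H.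
  replace (cos t * fst l - sin t * snd l) with (fst l * cos t - snd l * sin t) by ring.
  apply (is_derive_fst_path g (fun s => s * cos t) (fun s => s * sin t)); [ exact H | | ];
    auto_derive; trivial; ring.
Qed.

Lemma is_derive_snd_radius (g : C -> C) (l : C) r t :
  has_C_derive g (circle_point r t) l ->
  is_derive (fun s => snd (g (circle_point s t))) r (cos t * snd l + sin t * fst l).
Proof.
  intros H.
  replace (cos t * snd l + sin t * fst l) with (fst l * sin t + snd l * cos t) by ring.
  apply (is_derive_snd_path g (fun s => s * cos t) (fun s => s * sin t)); [ exact H | | ];
    auto_derive; trivial; ring.
Qed.

Lemma is_derive_fst_angle (g : C -> C) (l : C) r t :
  has_C_derive g (circle_point r t) l ->
  is_derive (fun s => fst (g (circle_point r s))) t (- r * (cos t * snd l + sin t * fst l)).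
Proof.
  intros H.
  replace (- r * (cos t * snd l + sin t * fst l)) with (fst l * (r * - sin t) - snd l * (r * cos t)) by ring.
  apply (is_derive_fst_path g (fun s => r * cos s) (fun s => r * sin s)); [ exact H | | ];
    auto_derive; trivial; ring.
Qed.

Lemma is_derive_snd_angle (g : C -> C) (l : C) r t :
  has_C_derive g (circle_point r t) l ->
  is_derive (fun s => snd (g (circle_point r s))) t (r * (cos t * fst l - sin t * snd l)).
Proof.
  intros H.
  replace (r * (cos t * fst l - sin t * snd l)) with (fst l * (r * cos t) + snd l * (r * - sin t)) by ring.
  apply (is_derive_snd_path g (fun s => r * cos s) (fun s => r * sin s)); [ exact H | | ];
    auto_derive; trivial; ring.
Qed.

Section AnalyticMean.

Variables g g1 g2 : C -> C.
Hypothesis Hg : twice_C_derivable_in_disc g g1 g2.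
Variables eps k : R.
Hypothesis HU : forall z, Cmod z < 1 -> 0 < Cmod (g z) ^ 2 + eps.

Let P r t := fst (g (circle_point r t)).
Let Q r t := snd (g (circle_point r t)).
Let P1 r t := fst (g1 (circle_point r t)).
Let Q1 r t := snd (g1 (circle_point r t)).
Let P2 r t := fst (g2 (circle_point r t)).
Let Q2 r t := snd (g2 (circle_point r t)).

Let a := rot_re P1 Q1.
Let b := rot_im P1 Q1.
Let al := rot_re (rot_re P2 Q2) (rot_im P2 Q2).
Let be := rot_im (rot_re P2 Q2) (rot_im P2 Q2).

Let Hd r t : Rabs r < 1 -> has_C_derive g (circle_point r t) (g1 (circle_point r t)).
Proof. intros Hr. apply Hg. rewrite Cmod_circle_point. exact Hr. Qed.

Let Hd1 r t : Rabs r < 1 -> has_C_derive g1 (circle_point r t) (g2 (circle_point r t)).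
Proof. intros Hr. apply Hg. rewrite Cmod_circle_point. exact Hr. Qed.

Let Har r t : Rabs r < 1 -> is_derive (fun s => a s t) r (al r t).
Proof.
  intros Hr. apply (is_derive_rot_re_radius P1 Q1 (rot_re P2 Q2) (rot_im P2 Q2)).
  apply is_derive_fst_radius, Hd1, Hr. apply is_derive_snd_radius, Hd1, Hr.
Qed.

Let Hbr r t : Rabs r < 1 -> is_derive (fun s => b s t) r (be r t).
Proof.
  intros Hr. apply (is_derive_rot_im_radius P1 Q1 (rot_re P2 Q2) (rot_im P2 Q2)).
  apply is_derive_fst_radius, Hd1, Hr. apply is_derive_snd_radius, Hd1, Hr.
Qed.

Let Hat r t : Rabs r < 1 -> is_derive (a r) t (- b r t - r * be r t).
Proof.
  intros Hr.
  assert (H1 := is_derive_fst_angle g1 _ r t (Hd1 r t Hr)).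
  assert (H2 := is_derive_snd_angle g1 _ r t (Hd1 r t Hr)).
  fold (P2 r t) (Q2 r t) in H1, H2.
  apply (is_derive_ext (fun s => cos s * P1 r s - sin s * Q1 r s)); [ reflexivity | ].
  change (is_derive (P1 r) t (- r * (cos t * Q2 r t + sin t * P2 r t))) in H1.
  change (is_derive (Q1 r) t (r * (cos t * P2 r t - sin t * Q2 r t))) in H2.
  auto_derive.
  - repeat split; eexists; eassumption.
  - rewrite (is_derive_unique (fun s : R => P1 r s) t _ H1), (is_derive_unique (fun s : R => Q1 r s) t _ H2).
    unfold b, be, rot_im, rot_re. ring.
Qed.

Let Hbt r t : Rabs r < 1 -> is_derive (b r) t (a r t + r * al r t).
Proof.
  intros Hr.
  assert (H1 := is_derive_fst_angle g1 _ r t (Hd1 r t Hr)).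
  assert (H2 := is_derive_snd_angle g1 _ r t (Hd1 r t Hr)).
  fold (P2 r t) (Q2 r t) in H1, H2.
  apply (is_derive_ext (fun s => cos s * Q1 r s + sin s * P1 r s)); [ reflexivity | ].
  change (is_derive (P1 r) t (- r * (cos t * Q2 r t + sin t * P2 r t))) in H1.
  change (is_derive (Q1 r) t (r * (cos t * P2 r t - sin t * Q2 r t))) in H2.
  auto_derive.
  - repeat split; eexists; eassumption.
  - rewrite (is_derive_unique (fun s : R => P1 r s) t _ H1), (is_derive_unique (fun s : R => Q1 r s) t _ H2).
    unfold a, al, rot_im, rot_re. ring.
Qed.

Let Ccos : polar_continuous (fun _ t => cos t).
Proof. apply polar_continuous_angle, continuous_cos. Qed.

Let Csin : polar_continuous (fun _ t => sin t).
Proof. apply polar_continuous_angle, continuous_sin. Qed.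

Let Crot_re u v : polar_continuous u -> polar_continuous v -> polar_continuous (rot_re u v).
Proof.
  intros Cu Cv. apply (polar_continuous_ext (fun r t => cos t * u r t + (-1) * (sin t * v r t))).
  { intros r t. unfold rot_re. ring. }
  polar_cont.
Qed.

Let Crot_im u v : polar_continuous u -> polar_continuous v -> polar_continuous (rot_im u v).
Proof.
  intros Cu Cv. unfold rot_im. polar_cont.
Qed.

Let CP : polar_continuous P.
Proof. apply (polar_continuous_comp (fun z => fst (g z))). intros z Hz. eapply continuous_fst_C, Hg, Hz. Qed.
Let CQ : polar_continuous Q.
Proof. apply (polar_continuous_comp (fun z => snd (g z))). intros z Hz. eapply continuous_snd_C, Hg, Hz. Qed.
Let CP1 : polar_continuous P1.
Proof. apply (polar_continuous_comp (fun z => fst (g1 z))). intros z Hz. eapply continuous_fst_C, Hg, Hz. Qed.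
Let CQ1 : polar_continuous Q1.
Proof. apply (polar_continuous_comp (fun z => snd (g1 z))). intros z Hz. eapply continuous_snd_C, Hg, Hz. Qed.
Let CP2 : polar_continuous P2.
Proof. apply (polar_continuous_comp (fun z => fst (g2 z))). intros z Hz. apply Hg, Hz. Qed.
Let CQ2 : polar_continuous Q2.
Proof. apply (polar_continuous_comp (fun z => snd (g2 z))). intros z Hz. apply Hg, Hz. Qed.

Let HUp r t : Rabs r < 1 -> 0 < P r t ^ 2 + Q r t ^ 2 + eps.
Proof.
  intros Hr. unfold P, Q. rewrite <- sq_Cmod. apply HU. rewrite Cmod_circle_point. exact Hr.
Qed.

Let mean_eq r :
  RInt (fun t => Rpower (P r t ^ 2 + Q r t ^ 2 + eps) k) 0 (2 * PI) =
  RInt (fun t => Rpower (Cmod (g (circle_point r t)) ^ 2 + eps) k) 0 (2 * PI).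
Proof. apply RInt_ext. intros t _. rewrite sq_Cmod. reflexivity. Qed.

Lemma power_mean_nondecreasing (r1 r2 : R) :
  (forall z, Cmod z < 1 -> 0 <= k * (eps + k * Cmod (g z) ^ 2)) ->
  0 <= r1 -> r1 <= r2 -> r2 < 1 ->
  RInt (fun t => Rpower (Cmod (g (circle_point r1 t)) ^ 2 + eps) k) 0 (2 * PI) <=
  RInt (fun t => Rpower (Cmod (g (circle_point r2 t)) ^ 2 + eps) k) 0 (2 * PI).
Proof.
  intros Hk H1 H12 H2. rewrite <- !mean_eq.
  apply (polar_mean_nondecreasing P Q a b al be eps k); auto.
  - intros r t Hr. apply is_derive_fst_radius, Hd, Hr.
  - intros r t Hr. apply is_derive_snd_radius, Hd, Hr.
  - intros r t Hr. apply is_derive_fst_angle, Hd, Hr.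
  - intros r t Hr. apply is_derive_snd_angle, Hd, Hr.
  - exact (Crot_re _ _ CP1 CQ1).
  - exact (Crot_im _ _ CP1 CQ1).
  - exact (Crot_re _ _ (Crot_re _ _ CP2 CQ2) (Crot_im _ _ CP2 CQ2)).
  - exact (Crot_im _ _ (Crot_re _ _ CP2 CQ2) (Crot_im _ _ CP2 CQ2)).
  - intros r. unfold P. rewrite circle_point_2PI. reflexivity.
  - intros r. unfold Q. rewrite circle_point_2PI. reflexivity.
  - intros r. unfold a, rot_re, P1, Q1. rewrite circle_point_2PI, cos_2PI, sin_2PI, cos_0, sin_0. reflexivity.
  - intros r. unfold b, rot_im, P1, Q1. rewrite circle_point_2PI, cos_2PI, sin_2PI, cos_0, sin_0. reflexivity.
  - intros r t Hr. unfold P, Q. rewrite <- sq_Cmod. apply Hk. rewrite Cmod_circle_point. exact Hr.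
Qed.

Lemma power_mean_growth (B r : R) :
  eps = 0 ->
  (forall z, Cmod z < 1 -> (Cmod (g1 z) * (1 - Cmod z)) ^ 2 <= B * Cmod (g z) ^ 2) ->
  0 <= r < 1 ->
  RInt (fun t => Rpower (Cmod (g (circle_point r t)) ^ 2 + eps) k) 0 (2 * PI) * Rpower (1 - r) (4 * k ^ 2 * B) <=
  RInt (fun t => Rpower (Cmod (g (circle_point 0 t)) ^ 2 + eps) k) 0 (2 * PI).
Proof.
  intros He HB Hr. rewrite <- !mean_eq.
  apply (polar_mean_growth P Q a b al be eps k); auto.
  - intros s t Hs. apply is_derive_fst_radius, Hd, Hs.
  - intros s t Hs. apply is_derive_snd_radius, Hd, Hs.
  - intros s t Hs. apply is_derive_fst_angle, Hd, Hs.
  - intros s t Hs. apply is_derive_snd_angle, Hd, Hs.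
  - exact (Crot_re _ _ CP1 CQ1).
  - exact (Crot_im _ _ CP1 CQ1).
  - exact (Crot_re _ _ (Crot_re _ _ CP2 CQ2) (Crot_im _ _ CP2 CQ2)).
  - exact (Crot_im _ _ (Crot_re _ _ CP2 CQ2) (Crot_im _ _ CP2 CQ2)).
  - intros s. unfold P. rewrite circle_point_2PI. reflexivity.
  - intros s. unfold Q. rewrite circle_point_2PI. reflexivity.
  - intros s. unfold a, rot_re, P1, Q1. rewrite circle_point_2PI, cos_2PI, sin_2PI, cos_0, sin_0. reflexivity.
  - intros s. unfold b, rot_im, P1, Q1. rewrite circle_point_2PI, cos_2PI, sin_2PI, cos_0, sin_0. reflexivity.
  - intros s t Hs.
    assert (Hs1 : Cmod (circle_point s t) = s) by (rewrite Cmod_circle_point, Rabs_pos_eq; lra).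
    specialize (HB (circle_point s t) ltac:(rewrite Hs1; lra)).
    rewrite Hs1, Rpow_mult_distr, !sq_Cmod in HB.
    replace (a s t ^ 2 + b s t ^ 2) with (((sin t)² + (cos t)²) * (P1 s t ^ 2 + Q1 s t ^ 2))
      by (unfold a, b, rot_re, rot_im, Rsqr; ring).
    rewrite sin2_cos2, Rmult_1_l. exact HB.
Qed.

End AnalyticMean.

(** * Powers and integral means *)

Lemma rpow_pos x p : 0 < x -> rpow x p = Rpower x p.
Proof. intros H. unfold rpow. destruct (Rlt_dec 0 x); [ reflexivity | contradiction ]. Qed.

Lemma rpow_npos x p : x <= 0 -> rpow x p = 0.
Proof. intros H. unfold rpow. destruct (Rlt_dec 0 x); [ lra | reflexivity ]. Qed.

Lemma rpow_ge_0 x p : 0 <= rpow x p.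
Proof. unfold rpow. destruct (Rlt_dec 0 x); [ left; apply exp_pos | lra ]. Qed.

Lemma rpow_le x y p : 0 < p -> x <= y -> rpow x p <= rpow y p.
Proof.
  intros Hp Hxy. destruct (Rlt_le_dec 0 x) as [Hx | Hx].
  - rewrite !rpow_pos by lra. apply Rle_Rpower_l; lra.
  - rewrite (rpow_npos x) by exact Hx. apply rpow_ge_0.
Qed.

Lemma rpow_mult x y p : 0 <= x -> 0 <= y -> rpow (x * y) p = rpow x p * rpow y p.
Proof.
  intros Hx Hy.
  destruct (Rle_lt_or_eq_dec _ _ Hx) as [Hx1 | <-]; [ | rewrite Rmult_0_l, !(rpow_npos 0) by lra; ring ].
  destruct (Rle_lt_or_eq_dec _ _ Hy) as [Hy1 | <-]; [ | rewrite Rmult_0_r, !(rpow_npos 0) by lra; ring ].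
  rewrite !rpow_pos by nra. symmetry. apply Rpower_mult_distr; assumption.
Qed.

Lemma le_Rpower_of_le_1 u p : 0 < u <= 1 -> p <= 1 -> u <= Rpower u p.
Proof.
  intros Hu Hp. rewrite <- (Rpower_1 u) at 1 by lra. unfold Rpower.
  assert (ln u <= 0) by (rewrite <- ln_1; apply ln_le; lra).
  destruct (Rle_lt_or_eq_dec (1 * ln u) (p * ln u) ltac:(nra)) as [H1 | ->]; [ | lra ].
  left. apply exp_increasing, H1.
Qed.

Lemma rpow_plus_le x y p :
  0 <= x -> 0 <= y -> p <= 1 -> rpow (x + y) p <= rpow x p + rpow y p.
Proof.
  intros Hx Hy Hp.
  destruct (Rle_lt_or_eq_dec _ _ Hx) as [Hx1 | <-]; [ | rewrite Rplus_0_l, (rpow_npos 0) by lra; lra ].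
  destruct (Rle_lt_or_eq_dec _ _ Hy) as [Hy1 | <-]; [ | rewrite Rplus_0_r, (rpow_npos 0) by lra; lra ].
  rewrite !rpow_pos by lra.
  set (s := x + y). assert (Hs : 0 < s) by (unfold s; lra).
  (* by homogeneity the summands may be taken with sum one, where [u <= u^p] *)
  assert (Hfrac : forall u, 0 < u -> u <= s -> Rpower s p * (u / s) <= Rpower u p).
  { intros u Hu Hus.
    assert (Hi : 0 < / s) by (apply Rinv_0_lt_compat; lra).
    assert (Hq : 0 < u / s <= 1).
    { split. unfold Rdiv; nra. apply (Rmult_le_reg_r s); [ lra | ]. unfold Rdiv. rewrite Rmult_assoc, Rinv_l; lra. }
    replace (Rpower u p) with (Rpower s p * Rpower (u / s) p).
    - apply Rmult_le_compat_l; [ left; apply exp_pos | ]. apply le_Rpower_of_le_1; assumption.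
    - rewrite Rpower_mult_distr by lra. f_equal. field. lra. }
  assert (H1 := Hfrac x Hx1 ltac:(unfold s; lra)).
  assert (H2 := Hfrac y Hy1 ltac:(unfold s; lra)).
  replace (Rpower s p) with (Rpower s p * (x / s) + Rpower s p * (y / s)) by (unfold s; field; fold s; lra).
  lra.
Qed.

Lemma rpow_sq x p : 0 <= x -> rpow (x ^ 2) (p / 2) = rpow x p.
Proof.
  intros Hx. destruct (Rle_lt_or_eq_dec _ _ Hx) as [Hx1 | <-].
  - rewrite !rpow_pos by nra. rewrite <- Rpower_pow by lra. rewrite Rpower_mult. f_equal. simpl. field.
  - rewrite !rpow_npos by (simpl; lra). reflexivity.
Qed.

(** Positivity of the exponent is what makes the value [0] at the origin continuous. *)
Lemma continuous_rpow p x : 0 < p -> continuous (fun u => rpow u p) x.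
Proof.
  intros Hp. destruct (Rtotal_order x 0) as [Hx | [Hx | Hx]].
  - apply (continuous_ext_loc _ (fun _ => 0)); [ | apply continuous_const ].
    generalize (open_lt 0 x Hx). apply filter_imp. intros u Hu. symmetry. apply rpow_npos. lra.
  - subst x. intros P [eps HP]. rewrite (rpow_npos 0) in HP by lra.
    exists (mkposreal (Rpower eps (/ p)) (exp_pos _)). intros u Hu.
    apply HP. change (Rabs (rpow u p - 0) < eps).
    change (Rabs (u - 0) < Rpower eps (/ p)) in Hu.
    rewrite Rminus_0_r in *. rewrite Rabs_pos_eq by apply rpow_ge_0.
    destruct (Rlt_le_dec 0 u) as [H | H].
    + rewrite Rabs_pos_eq in Hu by lra. rewrite rpow_pos by exact H.
      replace (pos eps) with (Rpower (Rpower eps (/ p)) p).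
      * apply Rlt_Rpower_l; lra.
      * rewrite Rpower_mult, Rinv_l by lra. apply Rpower_1, cond_pos.
    + rewrite rpow_npos by exact H. apply cond_pos.
  - apply (continuous_ext_loc _ (fun u => Rpower u p)).
    + generalize (open_gt 0 x Hx). apply filter_imp. intros u Hu. symmetry. apply rpow_pos. exact Hu.
    + apply (continuous_comp (fun u => p * ln u) exp); [ | apply continuous_exp ].
      apply (continuous_scal_r (V := R_NormedModule) p ln). apply continuous_ln. exact Hx.
Qed.

Lemma rpow_le_one_plus x p q : 0 <= x -> 0 < q <= p -> rpow x q <= 1 + rpow x p.
Proof.
  intros Hx Hq. generalize (rpow_ge_0 x p). intros Hp.
  destruct (Rle_lt_dec x 1) as [H1 | H1].
  - assert (rpow x q <= rpow 1 q) by (apply rpow_le; lra).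
    rewrite (rpow_pos 1) in H by lra.
    assert (E : Rpower 1 q = 1) by (unfold Rpower; rewrite ln_1, Rmult_0_r; apply exp_0). lra.
  - rewrite !rpow_pos in * by lra. assert (Rpower x q <= Rpower x p) by (apply Rle_Rpower; lra). lra.
Qed.

Definition C_derivable_in_disc (g : C -> C) : Prop :=
  forall z, Cmod z < 1 -> exists l, has_C_derive g z l.

Lemma continuous_Cmod_circle (g : C -> C) r t :
  C_derivable_in_disc g -> Rabs r < 1 -> continuous (fun s => Cmod (g (circle_point r s))) t.
Proof.
  intros Hg Hr. destruct (Hg (circle_point r t)) as [l Hl].
  { rewrite Cmod_circle_point. exact Hr. }
  apply (continuous_Cmod_path g (fun s => r * cos s) (fun s => r * sin s) t l Hl).
  - apply (ex_derive_continuous (fun s : R => r * cos s)). auto_derive. trivial.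
  - apply (ex_derive_continuous (fun s : R => r * sin s)). auto_derive. trivial.
Qed.

Definition power_integral (p : R) (g : C -> C) (r : R) : R :=
  RInt (fun t => rpow (Cmod (g (circle_point r t))) p) 0 (2 * PI).

Lemma ex_power_integral p g r :
  0 < p -> C_derivable_in_disc g -> Rabs r < 1 ->
  ex_RInt (fun t => rpow (Cmod (g (circle_point r t))) p) 0 (2 * PI).
Proof.
  intros Hp Hg Hr. apply (ex_RInt_continuous (V := R_CompleteNormedModule)). intros t _.
  apply (continuous_comp (fun s => Cmod (g (circle_point r s))) (fun u => rpow u p)).
  apply continuous_Cmod_circle; assumption. apply continuous_rpow, Hp.
Qed.

Lemma RInt_circle_const c : RInt (fun _ => c) 0 (2 * PI) = 2 * PI * c.
Proof.
  rewrite (RInt_const (V := R_CompleteNormedModule)). unfold scal; simpl. unfold mult; simpl. ring.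
Qed.

Lemma RInt_circle_plus (F G : R -> R) :
  ex_RInt F 0 (2 * PI) -> ex_RInt G 0 (2 * PI) ->
  ex_RInt (fun t => F t + G t) 0 (2 * PI) /\
  RInt (fun t => F t + G t) 0 (2 * PI) = RInt F 0 (2 * PI) + RInt G 0 (2 * PI).
Proof.
  intros HF HG. split.
  - apply (ex_RInt_plus (V := R_NormedModule) F G); assumption.
  - apply (RInt_plus (V := R_CompleteNormedModule) F G); assumption.
Qed.

Lemma RInt_circle_scal (F : R -> R) c :
  ex_RInt F 0 (2 * PI) ->
  ex_RInt (fun t => c * F t) 0 (2 * PI) /\
  RInt (fun t => c * F t) 0 (2 * PI) = c * RInt F 0 (2 * PI).
Proof.
  intros HF. split.
  - apply (ex_RInt_scal (V := R_NormedModule) F); assumption.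
  - apply (RInt_scal (V := R_CompleteNormedModule) F); assumption.
Qed.

Lemma two_PI_pos : 0 < 2 * PI.
Proof. generalize PI_RGT_0; lra. Qed.

Lemma ex_RInt_regularized_power (g : C -> C) (eps k r : R) :
  C_derivable_in_disc g -> Rabs r < 1 ->
  (forall z, Cmod z < 1 -> 0 < Cmod (g z) ^ 2 + eps) ->
  ex_RInt (fun t => Rpower (Cmod (g (circle_point r t)) ^ 2 + eps) k) 0 (2 * PI).
Proof.
  intros Hg Hr HU. apply (ex_RInt_continuous (V := R_CompleteNormedModule)). intros t _.
  unfold Rpower.
  apply (continuous_comp (fun s => k * ln (Cmod (g (circle_point r s)) ^ 2 + eps)) exp); [ | apply continuous_exp ].
  apply @continuous_mult; [ apply continuous_const | ].
  apply (continuous_comp (fun s => Cmod (g (circle_point r s)) ^ 2 + eps) ln).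
  - apply @continuous_plus; [ | apply continuous_const ].
    assert (Hc := continuous_Cmod_circle g r t Hg Hr).
    simpl. repeat apply @continuous_mult; try exact Hc. apply continuous_const.
  - apply continuous_ln, HU. rewrite Cmod_circle_point. exact Hr.
Qed.

Lemma twice_C_derivable_derivable g g1 g2 :
  twice_C_derivable_in_disc g g1 g2 -> C_derivable_in_disc g.
Proof. intros H z Hz. exists (g1 z). apply H, Hz. Qed.

(** [|g|^p] is not smooth at the zeros of [g].  Replacing it by
    [(|g|^2 + eps)^(p/2)] changes it by at most [eps^(p/2)], by subadditivity, and
    the means of the regularized function increase with the radius. *)
Lemma power_integral_nondecreasing (g g1 g2 : C -> C) (p r1 r2 : R) :
  twice_C_derivable_in_disc g g1 g2 -> 0 < p <= 1 ->
  0 <= r1 -> r1 <= r2 -> r2 < 1 ->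
  power_integral p g r1 <= power_integral p g r2.
Proof.
  intros Hg Hp H1 H12 H2.
  assert (Hg0 := twice_C_derivable_derivable _ _ _ Hg).
  assert (HR1 : Rabs r1 < 1) by (rewrite Rabs_pos_eq; lra).
  assert (HR2 : Rabs r2 < 1) by (rewrite Rabs_pos_eq; lra).
  apply le_epsilon. intros d Hd.
  assert (HPI := two_PI_pos).
  set (eta := d / (2 * PI)).
  assert (Heta : 0 < eta) by (apply Rdiv_lt_0_compat; lra).
  set (eps := Rpower eta (2 / p)).
  assert (Heps : 0 < eps) by apply exp_pos.
  assert (Epow : rpow eps (p / 2) = eta).
  { rewrite rpow_pos by exact Heps. unfold eps. rewrite Rpower_mult.
    replace (2 / p * (p / 2)) with 1 by (field; lra). apply Rpower_1, Heta. }
  assert (HU : forall z, Cmod z < 1 -> 0 < Cmod (g z) ^ 2 + eps).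
  { intros z _. generalize (Cmod_ge_0 (g z)). intros; nra. }
  apply Rle_trans with (RInt (fun t => Rpower (Cmod (g (circle_point r1 t)) ^ 2 + eps) (p / 2)) 0 (2 * PI)).
  { apply RInt_le; [ lra | apply ex_power_integral; lra || assumption | apply ex_RInt_regularized_power; assumption | ].
    intros t _. rewrite <- rpow_sq by apply Cmod_ge_0.
    generalize (Cmod_ge_0 (g (circle_point r1 t))); intros.
    rewrite <- rpow_pos by nra. apply rpow_le; lra. }
  apply Rle_trans with (RInt (fun t => Rpower (Cmod (g (circle_point r2 t)) ^ 2 + eps) (p / 2)) 0 (2 * PI)).
  { apply (power_mean_nondecreasing g g1 g2 Hg eps (p / 2)); try assumption.
    intros z _. apply Rmult_le_pos; [ lra | ]. generalize (Cmod_ge_0 (g z)). intros; nra. }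
  assert (E : power_integral p g r2 + d = RInt (fun t => rpow (Cmod (g (circle_point r2 t))) p + eta) 0 (2 * PI)).
  { destruct (RInt_circle_plus (fun t => rpow (Cmod (g (circle_point r2 t))) p) (fun _ => eta)) as [_ ->].
    - apply ex_power_integral; lra || assumption.
    - apply ex_RInt_const.
    - rewrite RInt_circle_const. unfold power_integral, eta. f_equal. field. lra. }
  rewrite E. apply RInt_le; [ lra | apply ex_RInt_regularized_power; assumption | | ].
  - apply (ex_RInt_plus (V := R_NormedModule)); [ apply ex_power_integral; lra || assumption | apply ex_RInt_const ].
  - intros t _. rewrite <- rpow_sq by apply Cmod_ge_0. rewrite <- Epow.
    generalize (Cmod_ge_0 (g (circle_point r2 t))); intros.
    rewrite <- rpow_pos by nra. apply rpow_plus_le; [ nra | lra | lra ].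
Qed.

Lemma nondecreasing_bounded_left_limit (F : R -> R) (M : R) :
  (forall x y, 0 <= x -> x <= y -> y < 1 -> F x <= F y) ->
  (forall x, 0 <= x < 1 -> F x <= M) ->
  exists l : R, filterlim F (at_left 1) (locally l).
Proof.
  intros Hmono HM.
  destruct (completeness (fun v => exists x, 0 <= x < 1 /\ v = F x)) as [l [Hub Hlub]].
  - exists M. intros v [x [Hx ->]]. apply HM, Hx.
  - exists (F 0), 0. split; [ lra | reflexivity ].
  - exists l. apply filterlim_locally. intros eps.
    assert (Hx0 : exists x0, 0 <= x0 < 1 /\ l - eps < F x0).
    { apply Classical_Prop.NNPP. intros Hno.
      assert (l <= l - eps).
      { apply Hlub. intros v [x [Hx ->]]. apply Rnot_lt_le. intros Hlt. apply Hno. exists x. split; assumption. }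
      generalize (cond_pos eps). lra. }
    destruct Hx0 as [x0 [Hx0 Hl]].
    assert (Hd : 0 < 1 - x0) by lra.
    exists (mkposreal _ Hd). intros y Hy Hy1.
    change (Rabs (y - 1) < 1 - x0) in Hy. apply Rabs_def2 in Hy.
    change (Rabs (F y - l) < eps).
    assert (F x0 <= F y) by (apply Hmono; lra).
    assert (F y <= l) by (apply Hub; exists y; split; [ lra | reflexivity ]).
    apply Rabs_def1; generalize (cond_pos eps); lra.
Qed.

(** * The quotient of two solutions *)

Lemma circle_point_segment (a b s t : R) :
  (circle_point a t + s * (circle_point b t - circle_point a t))%C = circle_point (a + s * (b - a)) t.
Proof. apply injective_projections; simpl; ring. Qed.

Lemma Cmod_circle_point_sub (a b t : R) :
  Cmod (circle_point b t - circle_point a t) = Rabs (b - a).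
Proof.
  replace (circle_point b t - circle_point a t)%C with (circle_point (b - a) t)
    by (apply injective_projections; simpl; ring).
  apply Cmod_circle_point.
Qed.

Section Quotient.

Variables A f f1 g g1 : C -> C.
Let f2 z := (- (A z * f z))%C.
Let g2 z := (- (A z * g z))%C.
Hypothesis Hf : twice_C_derivable_in_disc f f1 f2.
Hypothesis Hg : twice_C_derivable_in_disc g g1 g2.
Hypothesis HA : forall z, Cmod z < 1 -> Cmod (A z) * (1 - Cmod z ^ 2) ^ 2 <= 1.
Hypothesis Hf0 : forall z, Cmod z < 1 -> f z <> RtoC 0.

Lemma log_derivative_bound (z : C) :
  Cmod z < 1 -> Cmod (f1 z) * (1 - Cmod z) <= 20 * Cmod (f z).
Proof.
  apply (zero_free_log_derivative_bound A f f1); try assumption; apply Hf.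
Qed.

Lemma wronskian_constant (z : C) :
  Cmod z < 1 -> (g1 z * f z - g z * f1 z)%C = (g1 0 * f 0 - g 0 * f1 0)%C.
Proof.
  intros Hz.
  assert (Hb : Cmod ((g1 z * f z - g z * f1 z) - (g1 0 * f 0 - g 0 * f1 0)) <= 0 * Cmod (z - 0)).
  { apply (Cmod_sub_le_of_derive_bound (fun z => g1 z * f z - g z * f1 z)%C (fun _ => 0)).
    intros s Hs. set (w := (0 + s * (z - 0))%C).
    assert (Hw : Cmod w < 1).
    { unfold w. replace (0 + s * (z - 0))%C with (s * z)%C by ring.
      rewrite Cmod_mult, Cmod_R, Rabs_pos_eq by lra. generalize (Cmod_ge_0 z). nra. }
    split; [ | rewrite Cmod_0; lra ].
    destruct (Hf w Hw) as [Df [Df1 _]]. destruct (Hg w Hw) as [Dg [Dg1 _]].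
    replace (RtoC 0) with ((g2 w * f w + g1 w * f1 w) - (g1 w * f1 w + g w * f2 w))%C
      by (unfold f2, g2; ring).
    apply (has_C_derive_sub (fun z => g1 z * f z)%C (fun z => g z * f1 z)%C); apply has_C_derive_mult; assumption. }
  rewrite Rmult_0_l in Hb.
  assert (E : ((g1 z * f z - g z * f1 z) - (g1 0 * f 0 - g 0 * f1 0))%C = RtoC 0).
  { apply Cmod_eq_0, Rle_antisym; [ exact Hb | apply Cmod_ge_0 ]. }
  replace (g1 z * f z - g z * f1 z)%C with (((g1 z * f z - g z * f1 z) - (g1 0 * f 0 - g 0 * f1 0)) + (g1 0 * f 0 - g 0 * f1 0))%C by ring.
  rewrite E. ring.
Qed.

Let w0 := (g1 0 * f 0 - g 0 * f1 0)%C.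
Let h z := (g z / f z)%C.

Lemma quotient_derive (z : C) :
  Cmod z < 1 -> has_C_derive h z (w0 / (f z * f z))%C.
Proof.
  intros Hz. unfold w0. rewrite <- (wronskian_constant z Hz).
  apply has_C_derive_div; [ apply Hg, Hz | apply Hf, Hz | apply Hf0, Hz ].
Qed.

(** The logarithmic derivative bound makes [|f|^2 / (1 - s)^40] nondecreasing
    along each radius, with [40 = 2 * 20], and [1 - s] is at most halved between
    [a] and [(1 + a) / 2]. *)
Lemma radial_lower_bound (a u t : R) :
  0 <= a -> a <= u -> u <= (1 + a) / 2 -> a < 1 ->
  (/ 2) ^ 40 * Cmod (f (circle_point a t)) ^ 2 <= Cmod (f (circle_point u t)) ^ 2.
Proof.
  intros Ha Hau Hu Ha1.
  set (P := fun s => fst (f (circle_point s t))).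
  set (Q := fun s => snd (f (circle_point s t))).
  set (P1 := fun s => cos t * fst (f1 (circle_point s t)) - sin t * snd (f1 (circle_point s t))).
  set (Q1 := fun s => cos t * snd (f1 (circle_point s t)) + sin t * fst (f1 (circle_point s t))).
  set (F := fun s => (P s ^ 2 + Q s ^ 2) * (/ (1 - s)) ^ 40).
  set (F' := fun s => (2 * (P s * P1 s + Q s * Q1 s) * (1 - s) + 40 * (P s ^ 2 + Q s ^ 2)) * (/ (1 - s)) ^ 41).
  assert (HF : forall s, 0 <= s < 1 -> is_derive F s (F' s)).
  { intros s Hs.
    assert (Hd : has_C_derive f (circle_point s t) (f1 (circle_point s t))).
    { apply Hf. rewrite Cmod_circle_point, Rabs_pos_eq; lra. }
    assert (HP : is_derive P s (P1 s)) by (apply is_derive_fst_radius, Hd).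
    assert (HQ : is_derive Q s (Q1 s)) by (apply is_derive_snd_radius, Hd).
    set (V := fun s => (/ (1 - s)) ^ 40).
    assert (HV : is_derive V s (40 * (/ (1 - s)) ^ 41)).
    { assert (Hi : is_derive (fun s => / (1 - s)) s ((/ (1 - s)) ^ 2)).
      { auto_derive; [ lra | field; lra ]. }
      assert (Hp := is_derive_pow (fun s => / (1 - s)) 40 s _ Hi).
      replace (40 * (/ (1 - s)) ^ 41) with (INR 40 * (/ (1 - s)) ^ 2 * (/ (1 - s)) ^ Nat.pred 40); [ exact Hp | ].
      rewrite Rmult_assoc, <- pow_add. f_equal. rewrite INR_IZR_INZ. reflexivity. }
    apply (is_derive_ext (fun s => (P s ^ 2 + Q s ^ 2) * V s)); [ reflexivity | ].
    auto_derive.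
    - repeat split; eexists; eassumption.
    - rewrite (is_derive_unique (fun s : R => P s) s _ HP), (is_derive_unique (fun s : R => Q s) s _ HQ),
        (is_derive_unique (fun s : R => V s) s _ HV).
      unfold F'. change 41%nat with (1 + 40)%nat. rewrite pow_add. fold (V s). generalize (V s). intros X.
      rewrite pow_1. field. lra. }
  assert (Hle : F a <= F u).
  { apply (nondecreasing_of_derive_nonneg F F'); [ exact Hau | | ].
    - intros s Hs. split; [ apply HF; lra | ].
      apply Rmult_le_pos; [ | left; apply pow_lt, Rinv_0_lt_compat; lra ].
      set (z := circle_point s t).
      assert (Hz : Cmod z = s) by (unfold z; rewrite Cmod_circle_point, Rabs_pos_eq; lra).
      assert (Hlog := log_derivative_bound z ltac:(lra)). rewrite Hz in Hlog.
      assert (EP : P s ^ 2 + Q s ^ 2 = Cmod (f z) ^ 2) by (rewrite sq_Cmod; reflexivity).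
      rewrite EP.
      assert (Hprod : - (P s * P1 s + Q s * Q1 s) <= Cmod (f z) * Cmod (f1 z)).
      { assert (Hrot : Cmod ((cos t, sin t) * f1 z) = Cmod (f1 z)).
        { rewrite Cmod_mult. replace (Cmod (cos t, sin t)) with (Rabs 1); [ rewrite Rabs_R1; ring | ].
          rewrite <- (Cmod_circle_point 1 t). unfold circle_point. rewrite !Rmult_1_l. reflexivity. }
        rewrite <- Hrot, <- (Cmod_conj (f z)), <- Cmod_mult.
        eapply Rle_trans; [ | apply re_le_Cmod ].
        eapply Rle_trans; [ | rewrite <- Rabs_Ropp; apply Rle_abs ].
        right. unfold P, Q, P1, Q1. fold z. simpl. ring. }
      generalize (Cmod_ge_0 (f z)). intros Hfz.
      assert (Cmod (f z) * Cmod (f1 z) * (1 - s) <= 20 * Cmod (f z) ^ 2).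
      { replace (Cmod (f z) * Cmod (f1 z) * (1 - s)) with (Cmod (f z) * (Cmod (f1 z) * (1 - s))) by ring.
        replace (20 * Cmod (f z) ^ 2) with (Cmod (f z) * (20 * Cmod (f z))) by ring.
        apply Rmult_le_compat_l; assumption. }
      apply (Rmult_le_compat_r (1 - s)) in Hprod; lra.
    - intros s Hs. apply (ex_derive_continuous F). eexists. apply HF. lra. }
  unfold F in Hle.
  assert (Ea : P a ^ 2 + Q a ^ 2 = Cmod (f (circle_point a t)) ^ 2) by (rewrite sq_Cmod; reflexivity).
  assert (Eu : P u ^ 2 + Q u ^ 2 = Cmod (f (circle_point u t)) ^ 2) by (rewrite sq_Cmod; reflexivity).
  rewrite Ea, Eu in Hle.
  apply (Rmult_le_reg_r ((/ (1 - u)) ^ 40)).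
  { apply pow_lt, Rinv_0_lt_compat. lra. }
  eapply Rle_trans; [ | exact Hle ].
  rewrite (Rmult_comm ((/ 2) ^ 40)), Rmult_assoc, <- Rpow_mult_distr.
  apply Rmult_le_compat_l; [ apply pow2_ge_0 | ].
  apply pow_incr. split.
  - apply Rmult_le_pos; [ lra | left; apply Rinv_0_lt_compat; lra ].
  - rewrite <- Rinv_mult. apply Rinv_le_contravar; lra.
Qed.

(** The derivative of [h] is [w0 / f^2], and [|f|^2] loses at most the factor [2^40]
    on the way from [a] to [(1 + a) / 2], the midpoint of [a] and [1]. *)
Lemma quotient_step (a t : R) :
  0 <= a < 1 ->
  Cmod (h (circle_point ((1 + a) / 2) t)) <=
  Cmod (h (circle_point a t)) + Cmod w0 * 2 ^ 40 * (1 - a) * / (Cmod (f (circle_point a t)) ^ 2).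
Proof.
  intros Ha.
  set (za := circle_point a t). set (zb := circle_point ((1 + a) / 2) t).
  assert (Hfa : 0 < Cmod (f za) ^ 2).
  { apply pow_lt, Cmod_gt_0, Hf0. unfold za. rewrite Cmod_circle_point, Rabs_pos_eq; lra. }
  assert (H2 : 0 < (/ 2) ^ 40) by (apply pow_lt; lra).
  assert (Hb : Cmod (h zb - h za) <= (Cmod w0 / ((/ 2) ^ 40 * Cmod (f za) ^ 2)) * Cmod (zb - za)).
  { apply (Cmod_sub_le_of_derive_bound h (fun z => w0 / (f z * f z))%C).
    intros s Hs. unfold za, zb. rewrite circle_point_segment.
    set (u := a + s * ((1 + a) / 2 - a)).
    assert (Hu : a <= u /\ u <= (1 + a) / 2) by (unfold u; split; nra).
    assert (Hz : Cmod (circle_point u t) < 1) by (rewrite Cmod_circle_point, Rabs_pos_eq; lra).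
    split; [ apply quotient_derive, Hz | ].
    assert (Hne := Hf0 _ Hz).
    rewrite Cmod_div by (apply Cmult_neq_0; exact Hne).
    apply Rmult_le_compat_l; [ apply Cmod_ge_0 | ].
    apply Rinv_le_contravar; [ apply Rmult_lt_0_compat; assumption | ].
    rewrite Cmod_mult. replace (Cmod (f (circle_point u t)) * Cmod (f (circle_point u t)))
      with (Cmod (f (circle_point u t)) ^ 2) by ring.
    apply radial_lower_bound; lra. }
  assert (Hd : Cmod (zb - za) <= 1 - a).
  { unfold za, zb. rewrite Cmod_circle_point_sub, Rabs_pos_eq; lra. }
  replace (h zb) with (h za + (h zb - h za))%C by ring.
  eapply Rle_trans; [ apply Cmod_triangle | ]. apply Rplus_le_compat_l.
  eapply Rle_trans; [ exact Hb | ].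
  eapply Rle_trans; [ apply Rmult_le_compat_l; [ | exact Hd ] | ].
  - apply Rmult_le_pos; [ apply Cmod_ge_0 | ]. left. apply Rinv_0_lt_compat, Rmult_lt_0_compat; assumption.
  - right. rewrite pow_inv. unfold Rdiv. rewrite Rinv_mult, Rinv_inv. ring.
Qed.

(** The mean of [|h|^q] at [1 - 2^(-n)] grows with [n] by terms [2^(-n q) I], where
    [I] is the mean of [|f|^(-2 q)]; as [I] is [O(2^(1600 q^2 n))] and
    [1600 q^2 <= q / 2] for [q <= 1/3200], these terms decay like
    [lam^n = 2^(-n q / 2)]. *)
Lemma quotient_power_integral_bounded (q : R) :
  0 < q <= 1 / 3200 ->
  exists M, forall n : nat, power_integral q h (1 - (/ 2) ^ n) <= M.
Proof.
  intros Hq.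
  assert (HPI := two_PI_pos).
  assert (HU : forall z, Cmod z < 1 -> 0 < Cmod (f z) ^ 2 + 0).
  { intros z Hz. rewrite Rplus_0_r. apply pow_lt, Cmod_gt_0, Hf0, Hz. }
  set (I := fun r => RInt (fun t => Rpower (Cmod (f (circle_point r t)) ^ 2 + 0) (- q)) 0 (2 * PI)).
  set (lam := Rpower (/ 2) (q / 2)).
  assert (Hlam : 0 < lam < 1).
  { split; [ apply exp_pos | ]. unfold lam, Rpower. rewrite <- exp_0. apply exp_increasing.
    assert (ln (/ 2) < 0) by (rewrite <- ln_1; apply ln_increasing; lra). nra. }
  set (d := fun n : nat => (/ 2) ^ n).
  assert (Hd0 : forall n, 0 < d n) by (intros n; apply pow_lt; lra).
  assert (Hd1 : forall n, d n <= 1).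
  { induction n as [ | n IH ]; [ unfold d; simpl; lra | ].
    specialize (Hd0 n). unfold d in *. simpl. lra. }
  assert (Hfd := twice_C_derivable_derivable _ _ _ Hf).
  assert (Hhd : C_derivable_in_disc h).
  { intros z Hz. eexists. apply quotient_derive, Hz. }
  assert (HI0 : 0 <= I 0).
  { apply RInt_ge_0; [ lra | apply (ex_RInt_regularized_power f 0 (- q) 0); try assumption; rewrite Rabs_R0; lra | ].
    intros t _. left. apply exp_pos. }
  assert (HI : forall n, Rpower (d n) q * I (1 - d n) <= I 0 * lam ^ n).
  { intros n. specialize (Hd0 n). specialize (Hd1 n).
    assert (Hg0 := power_mean_growth f f1 f2 Hf 0 (- q) HU 400 (1 - d n) eq_refl).
    fold (I (1 - d n)) (I 0) in Hg0.
    replace (1 - (1 - d n)) with (d n) in Hg0 by ring.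
    assert (Hgr : I (1 - d n) * Rpower (d n) (4 * (- q) ^ 2 * 400) <= I 0).
    { apply Hg0; [ | lra ]. intros z Hz.
      replace (400 * Cmod (f z) ^ 2) with ((20 * Cmod (f z)) ^ 2) by ring.
      apply pow_incr. split; [ | apply log_derivative_bound, Hz ].
      apply Rmult_le_pos; [ apply Cmod_ge_0 | lra ]. }
    set (K := 4 * (- q) ^ 2 * 400) in *.
    assert (HK : K <= q / 2) by (unfold K; nra).
    replace (Rpower (d n) q) with (Rpower (d n) K * Rpower (d n) (q - K)) by (rewrite <- Rpower_plus; f_equal; ring).
    assert (Hl : Rpower (d n) (q - K) <= lam ^ n).
    { replace (lam ^ n) with (Rpower (d n) (q / 2)).
      - unfold Rpower. assert (ln (d n) <= 0) by (rewrite <- ln_1; apply ln_le; lra).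
        destruct (Rle_lt_or_eq_dec ((q - K) * ln (d n)) (q / 2 * ln (d n)) ltac:(nra)) as [H1 | ->]; [ | lra ].
        left. apply exp_increasing, H1.
      - unfold d, lam. rewrite <- !Rpower_pow by (try apply exp_pos; lra). rewrite !Rpower_mult. f_equal. ring. }
    replace (Rpower (d n) K * Rpower (d n) (q - K) * I (1 - d n))
      with ((I (1 - d n) * Rpower (d n) K) * Rpower (d n) (q - K)) by ring.
    eapply Rle_trans.
    - apply Rmult_le_compat_r; [ left; apply exp_pos | exact Hgr ].
    - apply Rmult_le_compat_l; assumption. }
  set (c := rpow (Cmod w0 * 2 ^ 40) q).
  assert (Hc : 0 <= c) by apply rpow_ge_0.
  assert (Hr : forall n, Rabs (1 - d n) < 1).
  { intros n. specialize (Hd0 n). specialize (Hd1 n). rewrite Rabs_pos_eq; lra. }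
  assert (Hstep : forall n, power_integral q h (1 - d (S n)) <= power_integral q h (1 - d n) + c * (I 0 * lam ^ n)).
  { intros n.
    assert (E1 := ex_power_integral q h (1 - d n) ltac:(lra) Hhd (Hr n)).
    assert (E2 := ex_RInt_regularized_power f 0 (- q) (1 - d n) Hfd (Hr n) HU).
    destruct (RInt_circle_scal _ (c * Rpower (d n) q) E2) as [E3 I3].
    destruct (RInt_circle_plus _ _ E1 E3) as [E4 I4].
    apply Rle_trans with (power_integral q h (1 - d n) + c * Rpower (d n) q * I (1 - d n)).
    - unfold I. rewrite <- I3. unfold power_integral at 2. rewrite <- I4.
      apply RInt_le; [ lra | apply ex_power_integral; auto; lra | exact E4 | ].
      intros t _. specialize (Hd0 n). specialize (Hd1 n).
      assert (Hs := quotient_step (1 - d n) t ltac:(lra)).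
      replace ((1 + (1 - d n)) / 2) with (1 - d (S n)) in Hs by (unfold d; simpl; field).
      replace (1 - (1 - d n)) with (d n) in Hs by ring.
      assert (Hfz : 0 < Cmod (f (circle_point (1 - d n) t)) ^ 2).
      { rewrite <- (Rplus_0_r (_ ^ 2)). apply HU. rewrite Cmod_circle_point, Rabs_pos_eq; lra. }
      set (v := Cmod (f (circle_point (1 - d n) t)) ^ 2) in *.
      assert (Hw : 0 <= Cmod w0 * 2 ^ 40) by (apply Rmult_le_pos; [ apply Cmod_ge_0 | apply pow_le; lra ]).
      assert (Hvi : 0 < / v) by (apply Rinv_0_lt_compat; exact Hfz).
      eapply Rle_trans; [ apply rpow_le; [ lra | exact Hs ] | ].
      eapply Rle_trans; [ apply rpow_plus_le; [ apply Cmod_ge_0 | | lra ] | ].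
      + apply Rmult_le_pos; [ apply Rmult_le_pos; lra | lra ].
      + apply Rplus_le_compat_l. right.
        rewrite rpow_mult by (try apply Rmult_le_pos; lra). rewrite rpow_mult by lra. fold c.
        rewrite (rpow_pos (d n)), (rpow_pos (/ v)) by assumption.
        f_equal. rewrite Rplus_0_r. unfold Rpower. f_equal. rewrite ln_Rinv by assumption. ring.
    - apply Rplus_le_compat_l. rewrite Rmult_assoc. apply Rmult_le_compat_l; [ exact Hc | apply HI ]. }
  exists (power_integral q h 0 + c * I 0 / (1 - lam)).
  assert (Hsum : forall n, power_integral q h (1 - d n) <= power_integral q h 0 + c * I 0 * ((1 - lam ^ n) / (1 - lam))).
  { induction n as [ | n IH ].
    - unfold d. simpl. rewrite Rminus_diag. unfold Rdiv. lra.
    - eapply Rle_trans; [ apply Hstep | ].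
      replace (c * I 0 * ((1 - lam ^ S n) / (1 - lam))) with (c * I 0 * ((1 - lam ^ n) / (1 - lam)) + c * (I 0 * lam ^ n))
        by (simpl; field; lra).
      lra. }
  intros n. eapply Rle_trans; [ apply Hsum | ]. apply Rplus_le_compat_l.
  unfold Rdiv. rewrite <- Rmult_assoc.
  apply Rmult_le_compat_r; [ left; apply Rinv_0_lt_compat; lra | ].
  assert (0 <= lam ^ n) by (apply pow_le; lra).
  assert (0 <= c * I 0) by (apply Rmult_le_pos; assumption). nra.
Qed.

End Quotient.

(** * Solutions in Hardy spaces *)

Lemma analytic_has_C_derive (f : C -> C) (z : C) :
  analytic_in_disc f -> Cmod z < 1 -> has_C_derive f z (C_derive f z).
Proof. intros Hf Hz. apply C_derive_correct; [ exact (RtoC 0) | apply Hf, Hz ]. Qed.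

Lemma analytic_solution_twice_derivable (A f : C -> C) :
  analytic_in_disc A -> analytic_solution A f ->
  twice_C_derivable_in_disc f (C_derive f) (fun z => - (A z * f z))%C.
Proof.
  intros HA [Hf [Hf1 Heq]] z Hz.
  assert (Hd2 := analytic_has_C_derive _ z Hf1 Hz).
  replace (C_derive (C_derive f) z) with (- (A z * f z))%C in Hd2.
  2:{ replace (C_derive (C_derive f) z) with ((C_derive (C_derive f) z + A z * f z) - A z * f z)%C by ring.
      rewrite (Heq z Hz). ring. }
  assert (HAf := has_C_derive_scal _ (-1) _ _ (has_C_derive_mult A f z _ _
     (analytic_has_C_derive A z HA Hz) (analytic_has_C_derive f z Hf Hz))).
  split; [ apply analytic_has_C_derive; assumption | split; [ exact Hd2 | split ] ].
  - eapply continuous_ext; [ | exact (continuous_fst_C _ _ _ HAf) ]. intros w. simpl. ring.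
  - eapply continuous_ext; [ | exact (continuous_snd_C _ _ _ HAf) ]. intros w. simpl. ring.
Qed.

Lemma normL0_le_pointwise (A : C -> C) (B : R) :
  Rbar_le (normL0 A) (Finite B) ->
  forall z, Cmod z < 1 -> Cmod (A z) * (1 - Cmod z ^ 2) ^ 2 <= B.
Proof.
  intros HA z Hz.
  destruct (Lub_Rbar_correct (fun x : R => exists z : C,
    in_disc z /\ x = Cmod (A z) * (1 - Cmod z ^ 2) ^ 2)) as [Hub _].
  exact (Rbar_le_trans (Finite _) _ (Finite _) (Hub _ (ex_intro _ z (conj Hz eq_refl))) HA).
Qed.

Lemma in_Hardy_power_integral_bounded (p : R) (f : C -> C) :
  in_Hardy p f ->
  exists M r0, r0 < 1 /\ forall r, r0 < r < 1 -> power_integral p f r <= M.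
Proof.
  intros [_ [l Hl]].
  destruct (proj1 (filterlim_locally (hardy_mean p f) l) Hl (mkposreal 1 Rlt_0_1)) as [d Hd].
  exists (2 * PI * (l + 1)), (1 - d). split; [ generalize (cond_pos d); lra | ].
  intros r Hr.
  assert (H : Rabs (hardy_mean p f r - l) < 1).
  { apply (Hd r); [ | lra ]. change (Rabs (r - 1) < d). apply Rabs_def1; lra. }
  apply Rabs_def2 in H.
  change (hardy_mean p f r) with (1 / (2 * PI) * power_integral p f r) in H.
  replace (power_integral p f r) with (2 * PI * (1 / (2 * PI) * power_integral p f r))
    by (field; generalize PI_RGT_0; lra).
  apply Rmult_le_compat_l; [ left; exact two_PI_pos | lra ].
Qed.

(** Since the means are monotone, it suffices to bound them at the radii
    [1 - 2^(-n)]. *)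
Lemma in_Hardy_of_power_integral_bounded_along (A g : C -> C) (p M : R) (N : nat) :
  analytic_in_disc A -> analytic_solution A g -> 0 < p <= 1 ->
  (forall n, (N <= n)%nat -> power_integral p g (1 - (/ 2) ^ n) <= M) ->
  in_Hardy p g.
Proof.
  intros HA Hg Hp HM.
  assert (Hg2 := analytic_solution_twice_derivable A g HA Hg).
  split; [ apply Hg | ].
  assert (HPI := two_PI_pos).
  assert (Hc : 0 < 1 / (2 * PI)) by (apply Rdiv_lt_0_compat; lra).
  apply (nondecreasing_bounded_left_limit _ (1 / (2 * PI) * M)).
  - intros x y Hx Hxy Hy. apply Rmult_le_compat_l; [ lra | ].
    exact (power_integral_nondecreasing g _ _ p x y Hg2 Hp Hx Hxy Hy).
  - intros x Hx. apply Rmult_le_compat_l; [ lra | ].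
    destruct (pow_lt_1_zero (/ 2) ltac:(rewrite Rabs_pos_eq; lra) (1 - x) ltac:(lra)) as [N1 HN1].
    set (n := Nat.max N N1).
    specialize (HN1 n ltac:(unfold n; lia)). specialize (HM n ltac:(unfold n; lia)).
    assert (Hpos : 0 < (/ 2) ^ n) by (apply pow_lt; lra).
    rewrite Rabs_pos_eq in HN1 by lra.
    eapply Rle_trans; [ | exact HM ].
    apply (power_integral_nondecreasing g _ _ p x _ Hg2 Hp); lra.
Qed.

Theorem theorem4 :
  forall A : C -> C,
    analytic_in_disc A ->
    Rbar_le (normL0 A) (Finite 1) ->
    (exists f : C -> C,
        analytic_solution A f /\
        (forall z : C, in_disc z -> f z <> RtoC 0) /\
        in_some_Hardy f) ->
    forall f : C -> C, analytic_solution A f -> in_some_Hardy f.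
Proof.
  intros A HA Hnorm [f [Hf [Hf0 [p [Hp HfH]]]]] g Hg.
  (* [q <= p] lets the means of [|f|^p] control those of [|f|^q]; [q <= 1/3200] bounds those of [|h|^q] *)
  set (q := Rmin p (1 / 3200)).
  assert (Hq0 : 0 < q) by (apply Rmin_pos; lra).
  assert (Hqp : q <= p) by apply Rmin_l.
  assert (Hq1 : q <= 1 / 3200) by apply Rmin_r.
  assert (Hf2 := analytic_solution_twice_derivable A f HA Hf).
  assert (Hg2 := analytic_solution_twice_derivable A g HA Hg).
  assert (HA1 := normL0_le_pointwise A 1 Hnorm).
  destruct (quotient_power_integral_bounded A f _ g _ Hf2 Hg2 HA1 Hf0 q (conj Hq0 Hq1)) as [Mh Hh].
  destruct (in_Hardy_power_integral_bounded p f HfH) as [Mf [r0 [Hr0 HMf]]].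
  destruct (pow_lt_1_zero (/ 2) ltac:(rewrite Rabs_pos_eq; lra) (1 - r0) ltac:(lra)) as [N HN].
  set (h := fun z => (g z / f z)%C) in *.
  assert (Hfd := twice_C_derivable_derivable _ _ _ Hf2).
  assert (Hhd : C_derivable_in_disc h).
  { intros z Hz. eexists. apply (quotient_derive A f _ g _ Hf2 Hg2 Hf0 z Hz). }
  exists (q / 2). split; [ lra | ].
  apply (in_Hardy_of_power_integral_bounded_along A g (q / 2) (2 * PI + Mf + Mh) (S N) HA Hg); [ lra | ].
  intros n Hn.
  set (r := 1 - (/ 2) ^ n).
  assert (Hpos : 0 < (/ 2) ^ n) by (apply pow_lt; lra).
  specialize (HN n ltac:(lia)). rewrite Rabs_pos_eq in HN by lra.
  assert (Hn1 : (/ 2) ^ n < 1) by (apply pow_lt_1_compat; [ lra | lia ]).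
  assert (Hr : Rabs r < 1) by (unfold r; rewrite Rabs_pos_eq; lra).
  specialize (HMf r ltac:(unfold r; lra)). specialize (Hh n). fold r in Hh.
  assert (Ef := ex_power_integral p f r Hp Hfd Hr).
  assert (Eh := ex_power_integral q h r Hq0 Hhd Hr).
  destruct (RInt_circle_plus (fun _ => 1) _ (ex_RInt_const 0 (2 * PI) 1) Ef) as [E1 I1].
  destruct (RInt_circle_plus _ _ E1 Eh) as [E2 I2].
  apply Rle_trans with (2 * PI + power_integral p f r + power_integral q h r); [ | lra ].
  assert (I0 : RInt (fun _ => 1) 0 (2 * PI) = 2 * PI) by (rewrite RInt_circle_const; apply Rmult_1_r).
  rewrite <- I0 at 1.
  unfold power_integral at 2 3. rewrite <- I1, <- I2.
  apply RInt_le; [ left; exact two_PI_pos | | exact E2 | ].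
  - apply ex_power_integral; [ lra | exact (twice_C_derivable_derivable _ _ _ Hg2) | exact Hr ].
  - intros t _. set (z := circle_point r t).
    assert (Hz : Cmod z < 1) by (unfold z; rewrite Cmod_circle_point; exact Hr).
    assert (Eg : Cmod (g z) = Cmod (f z) * Cmod (h z)).
    { rewrite <- Cmod_mult. unfold h. f_equal. field. apply Hf0, Hz. }
    rewrite Eg, rpow_mult by apply Cmod_ge_0.
    (* [x y <= (x^2 + y^2) / 2] with [x = |f|^(q/2)] and [y = |h|^(q/2)] *)
    generalize (rpow_le_one_plus (Cmod (f z)) p q (Cmod_ge_0 _) (conj Hq0 Hqp)). intros H1.
    rewrite <- (rpow_sq (Cmod (f z)) q), <- (rpow_sq (Cmod (h z)) q) in * by apply Cmod_ge_0.
    simpl in *. rewrite !Rmult_1_r, !rpow_mult in * by apply Cmod_ge_0.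
    generalize (rpow_ge_0 (Cmod (f z)) (q / 2)) (rpow_ge_0 (Cmod (h z)) (q / 2)).
    set (x := rpow (Cmod (f z)) (q / 2)) in *. set (y := rpow (Cmod (h z)) (q / 2)) in *.
    intros. generalize (pow2_ge_0 (x - y)). simpl. nra.
Qed.
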